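(* Let $\mathsf{C}$ be a strict braided monoidal category. The category $\mathsf{cocHBr}$ of cocommutative Hopf braces in $\mathsf{C}$ and the category $\mathsf{coc}\text{-}\mathsf{opBT}$ of cocommutative opposite brace triples in $\mathsf{C}$ are isomorphic.
   Context: **Conventions.** $\mathsf{C}$ is a strict braided monoidal category with tensor product $\otimes$, unit object $K$ and braiding $c$. An object written in the place of a morphism denotes its identity morphism. An algebra $(A,\eta_A,\mu_A)$ in $\mathsf{C}$ is unital and associative; a coalgebra $(C,\varepsilon_C,\delta_C)$ in $\mathsf{C}$ is counital and coassociative. The tensor product of algebras $A,B$ is an algebra with unit $\eta_A\otimes\eta_B$ and product $(\mu_A\otimes\mu_B)\circ(A\otimes c_{B,A}\otimes B)$; the tensor product of coalgebras $C,D$ is a coalgebra with counit $\varepsilon_C\otimes\varepsilon_D$ and coproduct $(C\otimes c_{C,D}\otimes D)\circ(\delta_C\otimes\delta_D)$. A Hopf algebra in $\mathsf{C}$ is a tuple $H=(H,\eta_H,\mu_H,\varepsilon_H,\delta_H,\lambda_H)$ where $(H,\eta_H,\mu_H)$ is an algebra, $(H,\varepsilon_H,\delta_H)$ is a coalgebra, $\eta_H$ and $\mu_H$ are coalgebra morphisms, and the antipode $\lambda_H\colon H\to H$ satisfies $\mu_H\circ(\lambda_H\otimes H)\circ\delta_H=\eta_H\circ\varepsilon_H=\mu_H\circ(H\otimes\lambda_H)\circ\delta_H$. A Hopf algebra morphism is a morphism of $\mathsf{C}$ that is both an algebra and a coalgebra morphism. $H$ is cocommutative if $c_{H,H}\circ\delta_H=\delta_H$.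 Put $\mu_H^{\mathrm{op}}=\mu_H\circ c_{H,H}^{-1}$ (if $H$ is cocommutative then $c_{H,H}\circ c_{H,H}=\mathrm{id}_{H\otimes H}$ by a result of Schauenburg, so $\mu_H^{\mathrm{op}}=\mu_H\circ c_{H,H}$). **Hopf braces.** A Hopf brace $\mathbb{H}=(H_1,H_2)$ in $\mathsf{C}$ consists of two Hopf algebras $H_1=(H,\eta_H^1,\mu_H^1,\varepsilon_H,\delta_H,\lambda_H^1)$ and $H_2=(H,\eta_H^2,\mu_H^2,\varepsilon_H,\delta_H,\lambda_H^2)$ in $\mathsf{C}$ with the same underlying coalgebra such that $$\mu_H^2\circ(H\otimes\mu_H^1)=\mu_H^1\circ(\mu_H^2\otimes\Gamma_{H_1})\circ(H\otimes c_{H,H}\otimes H)\circ(\delta_H\otimes H\otimes H),$$ where $\Gamma_{H_1}=\mu_H^1\circ(\lambda_H^1\otimes\mu_H^2)\circ(\delta_H\otimes H)$. It is cocommutative if $c_{H,H}\circ\delta_H=\delta_H$. A morphism of Hopf braces $(H_1,H_2)\to(B_1,B_2)$ is a morphism $f\colon H\to B$ in $\mathsf{C}$ such that $f\colon H_1\to B_1$ and $f\colon H_2\to B_2$ are Hopf algebra morphisms. $\mathsf{cocHBr}$ is the full subcategory of cocommutative Hopf braces. **Opposite brace triples.** Let $A=(A,\eta_A,\mu_A,\varepsilon_A,\delta_A,\lambda_A)$ be a Hopf algebra in $\mathsf{C}$ and let $m_A\colon A\otimes A\to A$ and $u_A\colon A\to A$ be morphisms in $\mathsf{C}$. Put $\widetilde{\mu}_A=\mu_A\circ(A\otimes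 m_A)\circ(\delta_A\otimes A)$. The triple $(A,m_A,u_A)$ is an opposite brace triple if: (i) $m_A$ is a coalgebra morphism; (ii) $m_A\circ(\eta_A\otimes A)=\mathrm{id}_A$; (iii) $m_A\circ(A\otimes\eta_A)=\varepsilon_A\otimes\eta_A$; (iv) $m_A\circ(A\otimes m_A)=m_A\circ(\mu_A^{\mathrm{op}}\otimes A)$; (v) $m_A\circ(A\otimes\widetilde{\mu}_A)=\widetilde{\mu}_A\circ(m_A\otimes m_A)\circ(A\otimes c_{A,A}\otimes A)\circ(\delta_A\otimes A\otimes A)$; (vi) $u_A$ is a coalgebra morphism; (vii) $u_A\circ u_A=\mathrm{id}_A$; (viii) $m_A\circ(A\otimes u_A)\circ\delta_A=\lambda_A$. It is cocommutative if $A$ is cocommutative. A morphism of opposite brace triples $(A,m_A,u_A)\to(B,m_B,u_B)$ is a Hopf algebra morphism $f\colon A\to B$ such that $f\circ m_A=m_B\circ(f\otimes f)$. $\mathsf{coc}\text{-}\mathsf{opBT}$ is the full subcategory of cocommutative opposite brace triples. *)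

(* Defs.v *)
From Stdlib Require Import ssreflect ProofIrrelevance.

Set Implicit Arguments.
Unset Strict Implicit.
Unset Printing Implicit Defensive.

Declare Scope cat_scope.
Delimit Scope cat_scope with cat.
Local Open Scope cat_scope.

Reserved Notation "g ∘ f" (at level 40, left associativity).
Reserved Notation "A ⊗ B" (at level 35, right associativity).
Reserved Notation "f ⊠ g" (at level 35, right associativity).

(** * Categories, functors, isomorphism of categories *)

Record category : Type := Category {
  ob :> Type;
  hom : ob -> ob -> Type;
  idm : forall A : ob, hom A A;
  comp : forall A B D : ob, hom B D -> hom A B -> hom A D;
  comp1m : forall (A B : ob) (f : hom A B), comp (idm B) f = f;
  compm1 : forall (A B : ob) (f : hom A B), comp f (idm A) = f;
  compA : forall (A B D E : ob) (h : hom D E) (g : hom B D) (f : hom A B),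
    comp h (comp g f) = comp (comp h g) f
}.

Arguments hom {c} A B.
Arguments idm {c} A.
Arguments comp {c A B D} g f.
Notation "g ∘ f" := (comp g f) : cat_scope.

Record functor (C D : category) : Type := Functor {
  fob :> C -> D;
  fhom : forall A B : C, hom A B -> hom (fob A) (fob B);
  fhom1 : forall A : C, fhom (idm A) = idm (fob A);
  fhomM : forall (A B E : C) (g : hom B E) (f : hom A B),
    fhom (g ∘ f) = fhom g ∘ fhom f
}.

Definition functor_id (C : category) : functor C C :=
  @Functor C C (fun A => A) (fun _ _ f => f)
    (fun _ => eq_refl) (fun _ _ _ _ _ => eq_refl).

Definition functor_comp (C D E : category)
  (G : functor D E) (F : functor C D) : functor C E.
Proof.
refine (@Functor C E (fun A => G (F A)) (fun A B f => fhom G (fhom F f)) _ _).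
- by move=> A; rewrite !fhom1.
- by move=> A B X g f; rewrite !fhomM.
Defined.

(* Isomorphism, not equivalence: the composites are equal to the identities. *)
Definition isomorphic_categories (C D : category) : Prop :=
  exists (F : functor C D) (G : functor D C),
    functor_comp G F = functor_id C /\ functor_comp F G = functor_id D.

Definition full_subcategory (C : category) (P : C -> Prop) : category.
Proof.
refine (@Category {A : C | P A}
  (fun A B => hom (proj1_sig A) (proj1_sig B))
  (fun A => idm (proj1_sig A))
  (fun A B D g f => g ∘ f) _ _ _).
- by move=> A B f; apply: comp1m.
- by move=> A B f; apply: compm1.
- by move=> A B D E h g f; apply: compA.
Defined.

(** * Strict braided monoidal categories *)

Definition idto (C : category) (A B : C) (e : A = B) : hom A B :=
  match e in _ = X return hom A X with eq_refl => idm A end.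

(* Strictness: the tensor product is associative and unital on objects up to
   [=], and on morphisms up to transport along these equalities; the transport
   is expressed by composing with the morphisms [idto].  The pentagon and the
   triangle need no axiom, since their sides are composites of [idto]'s. *)
Record strict_monoidal_category : Type := StrictMonoidalCategory {
  smc_category :> category;
  tens : smc_category -> smc_category -> smc_category;
  tensm : forall A A' B B' : smc_category,
    hom A A' -> hom B B' -> hom (tens A B) (tens A' B');
  unit_ob : smc_category;
  tensm1 : forall A B : smc_category,
    tensm (idm A) (idm B) = idm (tens A B);
  tensmM : forall (A A' A'' B B' B'' : smc_category)
      (f' : hom A' A'') (f : hom A A') (g' : hom B' B'') (g : hom B B'),
    tensm (f' ∘ f) (g' ∘ g) = tensm f' g' ∘ tensm f g;
  tens_assoc : forall A B D : smc_category,
    tens (tens A B) D = tens A (tens B D);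
  tens_unitl : forall A : smc_category, tens unit_ob A = A;
  tens_unitr : forall A : smc_category, tens A unit_ob = A;
  tensm_assoc : forall (A A' B B' D D' : smc_category)
      (f : hom A A') (g : hom B B') (h : hom D D'),
    idto (tens_assoc A' B' D') ∘ tensm (tensm f g) h =
    tensm f (tensm g h) ∘ idto (tens_assoc A B D);
  tensm_unitl : forall (A A' : smc_category) (f : hom A A'),
    idto (tens_unitl A') ∘ tensm (idm unit_ob) f = f ∘ idto (tens_unitl A);
  tensm_unitr : forall (A A' : smc_category) (f : hom A A'),
    idto (tens_unitr A') ∘ tensm f (idm unit_ob) = f ∘ idto (tens_unitr A)
}.

Arguments tens {s} A B.
Arguments tensm {s A A' B B'} f g.
Arguments unit_ob {s}.
Notation "A ⊗ B" := (tens A B) : cat_scope.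
Notation "f ⊠ g" := (tensm f g) : cat_scope.

Section IdentityCasts.
Variable C : strict_monoidal_category.

Definition asc (A B D : C) : hom ((A ⊗ B) ⊗ D) (A ⊗ (B ⊗ D)) :=
  idto (tens_assoc A B D).
Definition csa (A B D : C) : hom (A ⊗ (B ⊗ D)) ((A ⊗ B) ⊗ D) :=
  idto (eq_sym (tens_assoc A B D)).
Definition lun (A : C) : hom (unit_ob ⊗ A) A := idto (tens_unitl A).
Definition lnu (A : C) : hom A (unit_ob ⊗ A) := idto (eq_sym (tens_unitl A)).
Definition run (A : C) : hom (A ⊗ unit_ob) A := idto (tens_unitr A).

End IdentityCasts.

Arguments asc {C} A B D.
Arguments csa {C} A B D.
Arguments lun {C} A.
Arguments lnu {C} A.
Arguments run {C} A.

Record strict_braided_category : Type := StrictBraidedCategory {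
  sbc_monoidal :> strict_monoidal_category;
  braid : forall A B : sbc_monoidal, hom (A ⊗ B) (B ⊗ A);
  (* [braid_inv A B] is the inverse of [braid A B], with source [B ⊗ A]. *)
  braid_inv : forall A B : sbc_monoidal, hom (B ⊗ A) (A ⊗ B);
  braidK : forall A B : sbc_monoidal, braid_inv A B ∘ braid A B = idm (A ⊗ B);
  braidVK : forall A B : sbc_monoidal, braid A B ∘ braid_inv A B = idm (B ⊗ A);
  braid_natural : forall (A A' B B' : sbc_monoidal)
      (f : hom A A') (g : hom B B'),
    braid A' B' ∘ (f ⊠ g) = (g ⊠ f) ∘ braid A B;
  braid_tensr : forall A B D : sbc_monoidal,
    braid A (B ⊗ D) =
    csa B D A ∘ (idm B ⊠ braid A D) ∘ asc B A D ∘ (braid A B ⊠ idm D)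
      ∘ csa A B D;
  braid_tensl : forall A B D : sbc_monoidal,
    braid (A ⊗ B) D =
    asc D A B ∘ (braid A D ⊠ idm B) ∘ csa A D B ∘ (idm A ⊠ braid B D)
      ∘ asc A B D
}.

Arguments braid {s} A B.
Arguments braid_inv {s} A B.

(* A ⊗ c_{B,D} ⊗ E, with the bracketing used below *)
Definition midswap (C : strict_braided_category) (A B D E : C) :
    hom ((A ⊗ B) ⊗ (D ⊗ E)) ((A ⊗ D) ⊗ (B ⊗ E)) :=
  csa A D (B ⊗ E)
    ∘ (idm A ⊠ (asc D B E ∘ (braid B D ⊠ idm E) ∘ csa B D E))
    ∘ asc A B (D ⊗ E).

Arguments midswap {C} A B D E.

(** * Algebras, coalgebras, Hopf algebras *)

Record algebra_data (C : strict_braided_category) (A : C) : Type := AlgebraData {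
  alg_unit : hom unit_ob A;
  alg_mul : hom (A ⊗ A) A
}.

Record coalgebra_data (C : strict_braided_category) (A : C) : Type :=
  CoalgebraData {
  coalg_counit : hom A unit_ob;
  coalg_comul : hom A (A ⊗ A)
}.

Record is_algebra (C : strict_braided_category) (A : C) (a : algebra_data A) :
    Prop := IsAlgebra {
  algebra_mul1l : alg_mul a ∘ (alg_unit a ⊠ idm A) = lun A;
  algebra_mul1r : alg_mul a ∘ (idm A ⊠ alg_unit a) = run A;
  algebra_mulA :
    alg_mul a ∘ (alg_mul a ⊠ idm A) =
    alg_mul a ∘ (idm A ⊠ alg_mul a) ∘ asc A A A
}.

Record is_coalgebra (C : strict_braided_category) (A : C)
    (d : coalgebra_data A) : Prop := IsCoalgebra {
  coalgebra_counitl :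
    lun A ∘ (coalg_counit d ⊠ idm A) ∘ coalg_comul d = idm A;
  coalgebra_counitr :
    run A ∘ (idm A ⊠ coalg_counit d) ∘ coalg_comul d = idm A;
  coalgebra_comulA :
    asc A A A ∘ (coalg_comul d ⊠ idm A) ∘ coalg_comul d =
    (idm A ⊠ coalg_comul d) ∘ coalg_comul d
}.

Definition unit_coalgebra (C : strict_braided_category) :
    coalgebra_data (unit_ob : C) :=
  CoalgebraData (idm unit_ob) (lnu unit_ob).

Definition tens_coalgebra (C : strict_braided_category) (A B : C)
    (a : coalgebra_data A) (b : coalgebra_data B) : coalgebra_data (A ⊗ B) :=
  CoalgebraData
    (lun unit_ob ∘ (coalg_counit a ⊠ coalg_counit b))
    (midswap A A B B ∘ (coalg_comul a ⊠ coalg_comul b)).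

Record is_algebra_morphism (C : strict_braided_category) (A B : C)
    (a : algebra_data A) (b : algebra_data B) (f : hom A B) : Prop :=
  IsAlgebraMorphism {
  algmor_unit : f ∘ alg_unit a = alg_unit b;
  algmor_mul : f ∘ alg_mul a = alg_mul b ∘ (f ⊠ f)
}.

Record is_coalgebra_morphism (C : strict_braided_category) (A B : C)
    (a : coalgebra_data A) (b : coalgebra_data B) (f : hom A B) : Prop :=
  IsCoalgebraMorphism {
  coalgmor_counit : coalg_counit b ∘ f = coalg_counit a;
  coalgmor_comul : coalg_comul b ∘ f = (f ⊠ f) ∘ coalg_comul a
}.

Record is_hopf_algebra (C : strict_braided_category) (A : C)
    (a : algebra_data A) (d : coalgebra_data A) (s : hom A A) : Prop :=
  IsHopfAlgebra {
  hopf_is_algebra : is_algebra a;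
  hopf_is_coalgebra : is_coalgebra d;
  hopf_unit_coalgmor :
    is_coalgebra_morphism (unit_coalgebra C) d (alg_unit a);
  hopf_mul_coalgmor :
    is_coalgebra_morphism (tens_coalgebra d d) d (alg_mul a);
  hopf_antipodel :
    alg_mul a ∘ (s ⊠ idm A) ∘ coalg_comul d = alg_unit a ∘ coalg_counit d;
  hopf_antipoder :
    alg_mul a ∘ (idm A ⊠ s) ∘ coalg_comul d = alg_unit a ∘ coalg_counit d
}.

Record hopf_algebra (C : strict_braided_category) : Type := HopfAlgebra {
  hopf_ob :> C;
  hopf_alg : algebra_data hopf_ob;
  hopf_coalg : coalgebra_data hopf_ob;
  antipode : hom hopf_ob hopf_ob;
  hopf_axioms : is_hopf_algebra hopf_alg hopf_coalg antipode
}.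

Section HopfAlgebraTheory.
Variable C : strict_braided_category.

Definition eta (A : hopf_algebra C) : hom unit_ob (A : C) := alg_unit (hopf_alg A).
Definition mu (A : hopf_algebra C) : hom (A ⊗ A) (A : C) := alg_mul (hopf_alg A).
Definition epsilon (A : hopf_algebra C) : hom (A : C) unit_ob :=
  coalg_counit (hopf_coalg A).
Definition delta (A : hopf_algebra C) : hom (A : C) (A ⊗ A) :=
  coalg_comul (hopf_coalg A).
Definition mu_op (A : hopf_algebra C) : hom (A ⊗ A) (A : C) :=
  mu A ∘ braid_inv A A.

Record is_hopf_morphism (A B : hopf_algebra C) (f : hom (A : C) B) : Prop :=
  IsHopfMorphism {
  hopfmor_alg : is_algebra_morphism (hopf_alg A) (hopf_alg B) f;
  hopfmor_coalg : is_coalgebra_morphism (hopf_coalg A) (hopf_coalg B) f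
}.

Definition cocommutative (A : C) (d : coalgebra_data A) : Prop :=
  braid A A ∘ coalg_comul d = coalg_comul d.

Lemma hopf_morphism_id (A : hopf_algebra C) : @is_hopf_morphism A A (idm (A : C)).
Proof.
by split; split; rewrite ?tensm1 ?comp1m ?compm1.
Qed.

Lemma hopf_morphism_comp (A B D : hopf_algebra C)
  (g : hom (B : C) D) (f : hom (A : C) B) :
  is_hopf_morphism g -> is_hopf_morphism f -> is_hopf_morphism (g ∘ f).
Proof.
move=> [[gu gm] [gc gd]] [[fu fm] [fc fd]]; split; split.
- by rewrite -compA fu gu.
- by rewrite tensmM -compA fm !compA gm.
- by rewrite compA gc fc.
- by rewrite tensmM compA gd -compA fd compA.
Qed.

End HopfAlgebraTheory.

Arguments is_hopf_morphism {C} A B f.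

(** * Hopf braces *)

Record hopf_brace (C : strict_braided_category) : Type := HopfBrace {
  hb_ob : C;
  hb_coalg : coalgebra_data hb_ob;
  hb_alg1 : algebra_data hb_ob;
  hb_antipode1 : hom hb_ob hb_ob;
  hb_alg2 : algebra_data hb_ob;
  hb_antipode2 : hom hb_ob hb_ob;
  hb_hopf1 : is_hopf_algebra hb_alg1 hb_coalg hb_antipode1;
  hb_hopf2 : is_hopf_algebra hb_alg2 hb_coalg hb_antipode2;
  hb_compat :
    let H := hb_ob in
    let mu1 := alg_mul hb_alg1 in
    let mu2 := alg_mul hb_alg2 in
    let del := coalg_comul hb_coalg in
    let Gamma :=
      mu1 ∘ (hb_antipode1 ⊠ mu2) ∘ asc H H H ∘ (del ⊠ idm H) in
    mu2 ∘ (idm H ⊠ mu1) =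
    mu1 ∘ (mu2 ⊠ Gamma) ∘ midswap H H H H ∘ (del ⊠ idm (H ⊗ H))
}.

Section HopfBraceCategory.
Variable C : strict_braided_category.

Definition hb_fst (H : hopf_brace C) : hopf_algebra C := HopfAlgebra (hb_hopf1 H).
Definition hb_snd (H : hopf_brace C) : hopf_algebra C := HopfAlgebra (hb_hopf2 H).

Definition is_hopf_brace_morphism (H B : hopf_brace C)
    (f : hom (hb_ob H) (hb_ob B)) : Prop :=
  is_hopf_morphism (hb_fst H) (hb_fst B) f /\
  is_hopf_morphism (hb_snd H) (hb_snd B) f.

Lemma hopf_brace_morphism_id (H : hopf_brace C) :
  @is_hopf_brace_morphism H H (idm (hb_ob H)).
Proof. by split; apply: (hopf_morphism_id (_ : hopf_algebra C)). Qed.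

Lemma hopf_brace_morphism_comp (H B D : hopf_brace C)
  (g : hom (hb_ob B) (hb_ob D)) (f : hom (hb_ob H) (hb_ob B)) :
  is_hopf_brace_morphism g -> is_hopf_brace_morphism f ->
  is_hopf_brace_morphism (g ∘ f).
Proof.
by move=> [g1 g2] [f1 f2]; split; [exact: (hopf_morphism_comp g1 f1)
                                  | exact: (hopf_morphism_comp g2 f2)].
Qed.

Definition HBr : category.
Proof.
refine (@Category (hopf_brace C)
  (fun H B => {f : hom (hb_ob H) (hb_ob B) | is_hopf_brace_morphism f})
  (fun H => exist _ (idm (hb_ob H)) (hopf_brace_morphism_id H))
  (fun H B D g f => exist _ (proj1_sig g ∘ proj1_sig f)
     (hopf_brace_morphism_comp (proj2_sig g) (proj2_sig f))) _ _ _).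
- by move=> H B [f Hf]; apply: subset_eq_compat; rewrite comp1m.
- by move=> H B [f Hf]; apply: subset_eq_compat; rewrite compm1.
- by move=> H B D E h g f; apply: subset_eq_compat; rewrite compA.
Defined.

Definition cocHBr : category :=
  @full_subcategory HBr (fun H : hopf_brace C => cocommutative (hb_coalg H)).

End HopfBraceCategory.

(** * Opposite brace triples *)

Definition mu_tilde (C : strict_braided_category) (A : hopf_algebra C)
    (m : hom (A ⊗ A) (A : C)) : hom (A ⊗ A) (A : C) :=
  mu A ∘ (idm (A : C) ⊠ m) ∘ asc A A A ∘ (delta A ⊠ idm (A : C)).

Record is_opposite_brace_triple (C : strict_braided_category)
    (A : hopf_algebra C) (m : hom (A ⊗ A) (A : C)) (u : hom (A : C) (A : C)) :
    Prop := IsOppositeBraceTriple {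
  obt_m_coalgmor :
    is_coalgebra_morphism (tens_coalgebra (hopf_coalg A) (hopf_coalg A))
      (hopf_coalg A) m;
  obt_m_unitl : m ∘ (eta A ⊠ idm (A : C)) = lun A;
  (* the target of [epsilon A ⊠ eta A] is [K ⊗ A] *)
  obt_m_unitr : m ∘ (idm (A : C) ⊠ eta A) = lun A ∘ (epsilon A ⊠ eta A);
  obt_m_action :
    m ∘ (idm (A : C) ⊠ m) = m ∘ (mu_op A ⊠ idm (A : C)) ∘ csa A A A;
  obt_m_mu_tilde :
    m ∘ (idm (A : C) ⊠ mu_tilde m) =
    mu_tilde m ∘ (m ⊠ m) ∘ midswap A A A A ∘ (delta A ⊠ idm (A ⊗ A));
  obt_u_coalgmor : is_coalgebra_morphism (hopf_coalg A) (hopf_coalg A) u;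
  obt_u_invol : u ∘ u = idm (A : C);
  obt_m_antipode : m ∘ (idm (A : C) ⊠ u) ∘ delta A = antipode A
}.

Record opposite_brace_triple (C : strict_braided_category) : Type :=
  OppositeBraceTriple {
  obt_hopf : hopf_algebra C;
  obt_m : hom (obt_hopf ⊗ obt_hopf) (obt_hopf : C);
  obt_u : hom (obt_hopf : C) (obt_hopf : C);
  obt_axioms : is_opposite_brace_triple obt_m obt_u
}.

Section OppositeBraceTripleCategory.
Variable C : strict_braided_category.

(* Compatibility with [u] is not required of a morphism. *)
Definition is_opposite_brace_triple_morphism (A B : opposite_brace_triple C)
    (f : hom (obt_hopf A : C) (obt_hopf B)) : Prop :=
  is_hopf_morphism (obt_hopf A) (obt_hopf B) f /\
  f ∘ obt_m A = obt_m B ∘ (f ⊠ f).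

Lemma opposite_brace_triple_morphism_id (A : opposite_brace_triple C) :
  @is_opposite_brace_triple_morphism A A (idm (obt_hopf A : C)).
Proof.
by split; [apply: hopf_morphism_id | rewrite tensm1 comp1m compm1].
Qed.

Lemma opposite_brace_triple_morphism_comp (A B D : opposite_brace_triple C)
  (g : hom (obt_hopf B : C) (obt_hopf D)) (f : hom (obt_hopf A : C) (obt_hopf B)) :
  is_opposite_brace_triple_morphism g -> is_opposite_brace_triple_morphism f ->
  is_opposite_brace_triple_morphism (g ∘ f).
Proof.
move=> [gh gm] [fh fm]; split; first exact: hopf_morphism_comp.
by rewrite tensmM -compA fm !compA gm.
Qed.

Definition opBT : category.
Proof.
refine (@Category (opposite_brace_triple C)
  (fun A B => {f : hom (obt_hopf A : C) (obt_hopf B) |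
                 is_opposite_brace_triple_morphism f})
  (fun A => exist _ (idm (obt_hopf A : C))
     (opposite_brace_triple_morphism_id A))
  (fun A B D g f => exist _ (proj1_sig g ∘ proj1_sig f)
     (opposite_brace_triple_morphism_comp (proj2_sig g) (proj2_sig f))) _ _ _).
- by move=> A B [f Hf]; apply: subset_eq_compat; rewrite comp1m.
- by move=> A B [f Hf]; apply: subset_eq_compat; rewrite compm1.
- by move=> A B D E h g f; apply: subset_eq_compat; rewrite compA.
Defined.

Definition coc_opBT : category :=
  @full_subcategory opBT
    (fun A : opposite_brace_triple C => cocommutative (hopf_coalg (obt_hopf A))).

End OppositeBraceTripleCategory.

(* Main.v *)
(* Points of a Hopf algebra H over a cocommutative coalgebra X are the coalgebra morphisms
   X -> H.  If H is cocommutative they form a group under convolution, a Hopf brace makes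
   them a skew brace, and an opposite brace triple gives them the corresponding action.
   Writing · and ∘ for the products of H_1 and H_2, and inverses accordingly, the
   correspondence is the group-theoretic one:
     m (x, y) = (x^{-∘})^{-·} · (x^{-∘} ∘ y),   u (x) = x^{-·},   x · y = x ∘ m (x, y).
   Identities between morphisms out of H ⊗ H and H ⊗ H ⊗ H are tested on the generic points,
   the projections, which requires these tensor powers to be cocommutative coalgebras, that
   is, c_{H,H} to be an involution.  This is Schauenburg's theorem: cancelling the outer
   factors in c ∘ δ ∘ μ = δ ∘ μ leaves c ∘ c = id. *)

From Stdlib Require Import ssreflect ssrfun ProofIrrelevance FunctionalExtensionality.
Require Import Defs.

Set Implicit Arguments.
Unset Strict Implicit.
Unset Printing Implicit Defensive.

Local Open Scope cat_scope.

(** Strictness is given by propositional equations between objects, so diagrams carry casts.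
    Parallel casts agree by proof irrelevance, which takes the place of the coherence axioms. Its
    coalgebra axioms and the symmetry of the braiding are therefore obtained from diagrams; the
    argument by points starts after that. Inverses are points only if antipodes are coalgebra
    morphisms, which the definition of a Hopf algebra does not contain. This is extracted from the
    invertibility of (x, y) |-> (x, x y). The map m is the usual action of a skew brace taken at the
    inverse of x. It is thus contravariant in x, which explains [mu_op] in the axioms of a triple.
    Both functors keep the underlying morphism in C, so the isomorphism comes down to two equalities
    of records: one round trip rebuilds the algebra H_1, the other rebuilds m. *)

Notation "A ◁ f" := (idm A ⊠ f) (at level 35, right associativity).

(** * Casts and diagrams with a trailing strand *)

Section Casts.
Variable C : strict_monoidal_category.
Implicit Types A B D E Z : C.

Lemma idto_comp (c : category) (A B D : c) (e : A = B) (e' : B = D) :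
  idto e' ∘ idto e = idto (eq_trans e e').
Proof. by case: D / e'; rewrite comp1m. Qed.

Lemma idto_id (c : category) (A : c) (e : A = A) : idto e = idm A.
Proof. by rewrite (proof_irrelevance _ e eq_refl). Qed.

Lemma idto_irr (c : category) (A B : c) (e e' : A = B) : idto e = idto e'.
Proof. by rewrite (proof_irrelevance _ e e'). Qed.

Lemma tens_idtol A B B' (e : B = B') : A ◁ idto e = idto (f_equal (tens A) e).
Proof. by case: B' / e; rewrite /= tensm1. Qed.

Lemma tens_idtor A B B' (e : B = B') :
  idto e ⊠ idm A = idto (f_equal (fun D => D ⊗ A) e).
Proof. by case: B' / e; rewrite /= tensm1. Qed.

Lemma ascK A B D : csa A B D ∘ asc A B D = idm _.
Proof. by rewrite /csa /asc idto_comp idto_id. Qed.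

Lemma csaK A B D : asc A B D ∘ csa A B D = idm _.
Proof. by rewrite /csa /asc idto_comp idto_id. Qed.

Lemma lnuK A : lun A ∘ lnu A = idm _.
Proof. by rewrite /lun /lnu idto_comp idto_id. Qed.

Lemma lunK A : lnu A ∘ lun A = idm _.
Proof. by rewrite /lun /lnu idto_comp idto_id. Qed.

Definition rnu A : hom A (A ⊗ unit_ob) := idto (eq_sym (tens_unitr A)).

Lemma rnuK A : run A ∘ rnu A = idm _.
Proof. by rewrite /run /rnu idto_comp idto_id. Qed.

Lemma ascN A A' B B' D D' (f : hom A A') (g : hom B B') (h : hom D D') :
  asc A' B' D' ∘ ((f ⊠ g) ⊠ h) = (f ⊠ (g ⊠ h)) ∘ asc A B D.
Proof. exact: tensm_assoc. Qed.

Lemma csaN A A' B B' D D' (f : hom A A') (g : hom B B') (h : hom D D') :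
  csa A' B' D' ∘ (f ⊠ (g ⊠ h)) = ((f ⊠ g) ⊠ h) ∘ csa A B D.
Proof.
by rewrite -[X in csa _ _ _ ∘ X]compm1 -csaK [X in csa _ _ _ ∘ X]compA -ascN
  !compA ascK comp1m.
Qed.

Lemma lunN A A' (f : hom A A') : lun A' ∘ (idm unit_ob ⊠ f) = f ∘ lun A.
Proof. exact: tensm_unitl. Qed.

Lemma runN A A' (f : hom A A') : run A' ∘ (f ⊠ idm unit_ob) = f ∘ run A.
Proof. exact: tensm_unitr. Qed.

Lemma lnuN A A' (f : hom A A') : lnu A' ∘ f = (idm unit_ob ⊠ f) ∘ lnu A.
Proof.
by rewrite -[f in LHS]compm1 -(lnuK A) [f ∘ _]compA -lunN !compA lunK comp1m.
Qed.

(** This is how an identity between extended diagrams is read back: put Z = K. *)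
Lemma tens_unit_inj A B (f g : hom A B) : f ⊠ idm unit_ob = g ⊠ idm unit_ob -> f = g.
Proof.
by move=> e; rewrite -[f]compm1 -[g]compm1 -rnuK !compA -!runN e.
Qed.

Lemma whiskM A B D E (g : hom D E) (f : hom B D) : A ◁ (g ∘ f) = A ◁ g ∘ A ◁ f.
Proof. by rewrite -tensmM comp1m. Qed.

Lemma tens_split A A' B B' (f : hom A A') (g : hom B B') :
  f ⊠ g = (f ⊠ idm B') ∘ A ◁ g.
Proof. by rewrite -tensmM comp1m compm1. Qed.

Lemma tens_swap A A' B B' (f : hom A A') (g : hom B B') :
  (f ⊠ idm B') ∘ A ◁ g = A' ◁ g ∘ (f ⊠ idm B).
Proof. by rewrite -!tensmM !comp1m !compm1. Qed.

Lemma tensrM A B D E (g : hom D E) (f : hom B D) :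
  (g ∘ f) ⊠ idm A = (g ⊠ idm A) ∘ (f ⊠ idm A).
Proof. by rewrite -tensmM comp1m. Qed.

(* A morphism f is extended by a strand Z on its right, with source and target bracketed to
   the right, so that the casts disappear from diagrams; [tailmn] treats f with m inputs and
   n outputs.  The definitions are locked to keep [compA] from rewriting inside them. *)
Definition tail21 A B D (f : hom (A ⊗ B) D) Z : hom (A ⊗ (B ⊗ Z)) (D ⊗ Z) :=
  locked ((f ⊠ idm Z) ∘ csa A B Z).
Definition tail12 A B D (f : hom A (B ⊗ D)) Z : hom (A ⊗ Z) (B ⊗ (D ⊗ Z)) :=
  locked (asc B D Z ∘ (f ⊠ idm Z)).
Definition tail22 A B D E (f : hom (A ⊗ B) (D ⊗ E)) Z :
    hom (A ⊗ (B ⊗ Z)) (D ⊗ (E ⊗ Z)) :=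
  locked (asc D E Z ∘ (f ⊠ idm Z) ∘ csa A B Z).
Definition tail10 A (f : hom A unit_ob) Z : hom (A ⊗ Z) Z := locked (lun Z ∘ (f ⊠ idm Z)).
Definition tail01 A (f : hom unit_ob A) Z : hom Z (A ⊗ Z) := locked ((f ⊠ idm Z) ∘ lnu Z).

Lemma tail21E A B D (f : hom (A ⊗ B) D) Z : tail21 f Z = (f ⊠ idm Z) ∘ csa A B Z.
Proof. by rewrite /tail21 -lock. Qed.
Lemma tail12E A B D (f : hom A (B ⊗ D)) Z : tail12 f Z = asc B D Z ∘ (f ⊠ idm Z).
Proof. by rewrite /tail12 -lock. Qed.
Lemma tail22E A B D E (f : hom (A ⊗ B) (D ⊗ E)) Z :
  tail22 f Z = asc D E Z ∘ (f ⊠ idm Z) ∘ csa A B Z.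
Proof. by rewrite /tail22 -lock. Qed.
Lemma tail10E A (f : hom A unit_ob) Z : tail10 f Z = lun Z ∘ (f ⊠ idm Z).
Proof. by rewrite /tail10 -lock. Qed.
Lemma tail01E A (f : hom unit_ob A) Z : tail01 f Z = (f ⊠ idm Z) ∘ lnu Z.
Proof. by rewrite /tail01 -lock. Qed.

Lemma tail21N A B D (f : hom (A ⊗ B) D) Z Z' (h : hom Z Z') :
  tail21 f Z' ∘ A ◁ (B ◁ h) = D ◁ h ∘ tail21 f Z.
Proof.
by rewrite !tail21E -compA csaN tensm1 !compA tens_swap.
Qed.

Lemma tail12N A B D (f : hom A (B ⊗ D)) Z Z' (h : hom Z Z') :
  tail12 f Z' ∘ A ◁ h = B ◁ (D ◁ h) ∘ tail12 f Z.
Proof.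
by rewrite !tail12E -compA tens_swap !compA -ascN tensm1.
Qed.

Lemma tail22N A B D E (f : hom (A ⊗ B) (D ⊗ E)) Z Z' (h : hom Z Z') :
  tail22 f Z' ∘ A ◁ (B ◁ h) = D ◁ (E ◁ h) ∘ tail22 f Z.
Proof.
by rewrite !tail22E -compA csaN tensm1 -compA [_ ∘ (_ ∘ csa _ _ _)]compA tens_swap !compA
  -ascN tensm1.
Qed.

Lemma tail10N A (f : hom A unit_ob) Z Z' (h : hom Z Z') :
  tail10 f Z' ∘ A ◁ h = h ∘ tail10 f Z.
Proof. by rewrite !tail10E -compA tens_swap !compA lunN. Qed.

Lemma tail01N A (f : hom unit_ob A) Z Z' (h : hom Z Z') :
  tail01 f Z' ∘ h = A ◁ h ∘ tail01 f Z.
Proof. by rewrite !tail01E -compA lnuN !compA tens_swap. Qed.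

End Casts.

(** Writes associators and unitors, whiskered or not, as [idto]. Once adjacent casts are merged, a
    coherence condition is an equation between two parallel casts, closed by [idto_irr]. *)
Ltac casts := rewrite ?whiskM ?tensrM /asc /csa /lun /lnu /run /rnu ?(tens_idtol, tens_idtor).

Section Tails.
Variable C : strict_monoidal_category.
Implicit Types A B D E Z : C.

Lemma tensrA A A' B D (f : hom A A') :
  f ⊠ idm (B ⊗ D) = asc A' B D ∘ ((f ⊠ idm B) ⊠ idm D) ∘ csa A B D.
Proof. by rewrite ascN -compA csaK compm1 tensm1. Qed.

Lemma tensmidA A A' B D (f : hom A A') :
  (B ◁ f) ⊠ idm D = csa B A' D ∘ (B ◁ (f ⊠ idm D)) ∘ asc B A D.
Proof. by rewrite csaN -compA ascK compm1. Qed.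

End Tails.

Lemma idto_compl (c : category) (A B D E : c) (e : A = B) (e' : B = D) (f : hom E A) :
  idto e' ∘ (idto e ∘ f) = idto (eq_trans e e') ∘ f.
Proof. by rewrite compA idto_comp. Qed.

Ltac merge_casts := rewrite -?compA ?idto_comp ?idto_compl.

Lemma comp_congr (c : category) (A B D : c) (g g' : hom B D) (f f' : hom A B) :
  g = g' -> f = f' -> g ∘ f = g' ∘ f'.
Proof. by move=> -> ->. Qed.

Ltac match_casts := repeat first [exact: idto_irr | reflexivity | apply: comp_congr].

(** Modulo casts the second hypothesis reads x = x ∘ x, and a left-cancellable idempotent is an
    identity. It serves to compute the braiding with the unit object. *)
Lemma idto_of_idem (c : category) (A B S : c) (x : hom A B) (i l : S = A)
    (j : B = B) (k : B = A) :
  (forall f g : hom A A, x ∘ f = x ∘ g -> f = g) ->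
  x ∘ idto i = idto j ∘ (x ∘ (idto k ∘ (x ∘ idto l))) -> x = idto (eq_sym k).
Proof.
move=> x_inj; rewrite (idto_irr l i) idto_id comp1m => e.
have kx : idto k ∘ x = idm _.
  apply: x_inj; rewrite compm1.
  transitivity (x ∘ idto i ∘ idto (eq_sym i)).
    by rewrite e -!compA idto_comp idto_id compm1.
  by rewrite -compA idto_comp idto_id compm1.
by rewrite -[LHS]comp1m -(idto_id (eq_trans k (eq_sym k))) -idto_comp -compA kx compm1.
Qed.

(** * Hexagons, naturality and unit laws of the braiding with a trailing strand *)

Section BraidTails.
Variable C : strict_braided_category.
Implicit Types A B D E Z : C.
Notation brT A B Z := (tail22 (braid A B) Z).

(** The hexagon. With the trailing strand, all its inner casts vanish and only a rebracketing at
    each end is left. *)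
Lemma brT_tensl A B D Z :
  (D ◁ asc A B Z) ∘ brT (A ⊗ B) D Z ∘ csa A B (D ⊗ Z) =
  brT A D (B ⊗ Z) ∘ A ◁ brT B D Z.
Proof.
rewrite !tail22E braid_tensl !tensrA !tensrM tensmidA !whiskM.
casts; merge_casts.
by match_casts.
Qed.

Lemma brT_tensr A B D Z :
  asc B D (A ⊗ Z) ∘ brT A (B ⊗ D) Z ∘ (A ◁ csa B D Z) =
  B ◁ brT A D Z ∘ brT A B (D ⊗ Z).
Proof.
rewrite !tail22E braid_tensr !tensrA !tensrM tensmidA !whiskM.
casts; merge_casts.
by match_casts.
Qed.

Lemma braid_inj A B D (f g : hom D (A ⊗ B)) : braid A B ∘ f = braid A B ∘ g -> f = g.
Proof. by move=> e; rewrite -[f]comp1m -[g]comp1m -braidK -!compA e. Qed.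

Lemma tens_unitlE A B (f : hom A B) : idm unit_ob ⊠ f = lnu B ∘ f ∘ lun A.
Proof. by rewrite -compA -lunN compA lunK comp1m. Qed.

Lemma tens_unitrE A B (f : hom A B) : f ⊠ idm unit_ob = rnu B ∘ f ∘ run A.
Proof. by rewrite -compA -runN compA /run /rnu idto_comp idto_id comp1m. Qed.

Lemma braid_unitl A : braid unit_ob A = rnu A ∘ lun A.
Proof.
(* Naturality along the cast K ⊗ K = K, with the hexagon applied to [braid (K ⊗ K) A], shows that
   [braid K A] is idempotent modulo casts. *)
have := braid_natural (lun (unit_ob : C)) (idm A).
rewrite braid_tensl tens_unitlE tens_unitrE; casts; merge_casts.
move/idto_of_idem => -> //; first exact: braid_inj.
exact: idto_irr.
Qed.

Lemma braid_unitr A : braid A unit_ob = lnu A ∘ run A.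
Proof.
have := braid_natural (idm A) (lun (unit_ob : C)).
rewrite braid_tensr tens_unitlE tens_unitrE; casts; merge_casts.
move/idto_of_idem => -> //; first exact: braid_inj.
exact: idto_irr.
Qed.

Lemma brTN A A' B B' (f : hom A A') (g : hom B B') Z :
  brT A' B' Z ∘ (f ⊠ (g ⊠ idm Z)) = (g ⊠ (f ⊠ idm Z)) ∘ brT A B Z.
Proof.
by rewrite !tail22E -!compA csaN [_ ∘ (_ ∘ csa _ _ _)]compA -tensmM braid_natural comp1m
  -[X in _ ⊠ X]comp1m tensmM !compA ascN.
Qed.

Lemma brT_mull A B E D (f : hom (A ⊗ B) E) Z :
  brT E D Z ∘ tail21 f (D ⊗ Z) =
  D ◁ tail21 f Z ∘ (brT A D (B ⊗ Z) ∘ A ◁ brT B D Z).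
Proof.
rewrite -brT_tensl !tail21E whiskM !compA -[_ ∘ _ ∘ D ◁ asc _ _ _]compA.
by rewrite -whiskM ascK tensm1 compm1 -brTN tensm1.
Qed.

Lemma brT_mulr A B E D (f : hom (B ⊗ D) E) Z :
  brT A E Z ∘ A ◁ tail21 f Z =
  tail21 f (A ⊗ Z) ∘ (B ◁ brT A D Z ∘ brT A B (D ⊗ Z)).
Proof.
rewrite -brT_tensr !tail21E whiskM !compA -[_ ∘ _ ∘ asc _ _ _]compA.
by rewrite ascK compm1 brTN tensm1.
Qed.

Lemma brT_comull A B E D (f : hom E (A ⊗ B)) Z :
  brT A D (B ⊗ Z) ∘ (A ◁ brT B D Z ∘ tail12 f (D ⊗ Z)) =
  D ◁ tail12 f Z ∘ brT E D Z.
Proof.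
rewrite compA -brT_tensl !tail12E whiskM -!compA [csa _ _ _ ∘ _]compA ascK comp1m.
by rewrite -tensm1 brTN.
Qed.

Lemma brT_comulr A B E D (f : hom E (B ⊗ D)) Z :
  B ◁ brT A D Z ∘ (brT A B (D ⊗ Z) ∘ A ◁ tail12 f Z) =
  tail12 f (A ⊗ Z) ∘ brT A E Z.
Proof.
rewrite compA -brT_tensr !tail12E whiskM -!compA [A ◁ csa _ _ _ ∘ _]compA -whiskM ascK
  tensm1 comp1m.
by rewrite -[in RHS]tensm1 brTN.
Qed.

Lemma brT_unit_l D Z : brT unit_ob D Z = D ◁ lnu Z ∘ lun (D ⊗ Z).
Proof.
rewrite !tail22E braid_unitl; casts; merge_casts; exact: idto_irr.
Qed.

Lemma brT_unit_r D Z : brT D unit_ob Z = lnu (D ⊗ Z) ∘ D ◁ lun Z.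
Proof.
rewrite !tail22E braid_unitr; casts; merge_casts; exact: idto_irr.
Qed.

Lemma brT_unitl A D (f : hom unit_ob A) Z :
  brT A D Z ∘ tail01 f (D ⊗ Z) = D ◁ tail01 f Z.
Proof.
by rewrite !tail01E compA -tensm1 brTN brT_unit_l whiskM -!compA lnuK compm1.
Qed.

Lemma brT_unitr A D (f : hom unit_ob D) Z :
  brT A D Z ∘ A ◁ tail01 f Z = tail01 f (A ⊗ Z).
Proof.
rewrite !tail01E whiskM compA brTN brT_unit_r -!compA -[A ◁ lun _ ∘ _]whiskM lnuK.
by rewrite !tensm1 compm1.
Qed.

Lemma brT_counitl A D (f : hom A unit_ob) Z :
  D ◁ tail10 f Z ∘ brT A D Z = tail10 f (D ⊗ Z).
Proof.
by rewrite !tail10E whiskM -!compA -brTN brT_unit_l !compA -whiskM lnuK !tensm1 comp1m.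
Qed.

Lemma brT_counitr A D (f : hom D unit_ob) Z :
  tail10 f (A ⊗ Z) ∘ brT A D Z = A ◁ tail10 f Z.
Proof.
by rewrite !tail10E whiskM -!compA -[idm (A ⊗ Z)]tensm1 -brTN brT_unit_r !compA lnuK comp1m.
Qed.

End BraidTails.

(** * Algebra and coalgebra axioms with a trailing strand *)

Section TailAxioms.
Variable C : strict_braided_category.
Implicit Types A B D E Z : C.
Notation brT A B Z := (tail22 (braid A B) Z).

Lemma csa_pentagon A B D Z :
  (asc A B D ⊠ idm Z) ∘ (csa (A ⊗ B) D Z ∘ csa A B (D ⊗ Z)) =
  csa A (B ⊗ D) Z ∘ A ◁ csa B D Z.
Proof. by casts; merge_casts; exact: idto_irr. Qed.

Lemma asc_pentagon A B D Z :
  asc A B (D ⊗ Z) ∘ (asc (A ⊗ B) D Z ∘ (csa A B D ⊠ idm Z)) =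
  A ◁ asc B D Z ∘ asc A (B ⊗ D) Z.
Proof. by casts; merge_casts; exact: idto_irr. Qed.

Section Algebra.
Variables (A : C) (a : algebra_data A).
Hypothesis Ha : is_algebra a.

Lemma tail_mulA Z :
  tail21 (alg_mul a) Z ∘ tail21 (alg_mul a) (A ⊗ Z) =
  tail21 (alg_mul a) Z ∘ A ◁ tail21 (alg_mul a) Z.
Proof.
rewrite !tail21E whiskM -!compA [csa _ _ _ ∘ _]compA -{1}tensm1 csaN.
rewrite -compA [LHS]compA -tensrM (algebra_mulA Ha) 2!tensrM -!compA csa_pentagon.
by rewrite [csa _ _ _ ∘ (A ◁ (_ ⊠ _) ∘ _)]compA csaN !compA.
Qed.

Lemma tail_mul1l Z : tail21 (alg_mul a) Z ∘ tail01 (alg_unit a) (A ⊗ Z) = idm _.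
Proof.
rewrite tail21E tail01E -!compA [csa _ _ _ ∘ _]compA -{1}tensm1 csaN -compA [LHS]compA -tensrM.
by rewrite (algebra_mul1l Ha); casts; merge_casts; exact: idto_id.
Qed.

Lemma tail_mul1r Z : tail21 (alg_mul a) Z ∘ A ◁ tail01 (alg_unit a) Z = idm _.
Proof.
rewrite tail21E tail01E whiskM -!compA [csa _ _ _ ∘ _]compA csaN -compA [LHS]compA -tensrM.
by rewrite (algebra_mul1r Ha); casts; merge_casts; exact: idto_id.
Qed.
End Algebra.

Section Coalgebra.
Variables (A : C) (d : coalgebra_data A).

Lemma tail_comulE Z :
  A ◁ tail12 (coalg_comul d) Z ∘ tail12 (coalg_comul d) Z =
    A ◁ asc A A Z ∘ asc A (A ⊗ A) Z ∘
      (((A ◁ coalg_comul d) ∘ coalg_comul d) ⊠ idm Z).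
Proof.
rewrite !tail12E whiskM tensrM -!compA; congr (_ ∘ _).
by rewrite !compA ascN.
Qed.

Lemma tail_comulE' Z :
  tail12 (coalg_comul d) (A ⊗ Z) ∘ tail12 (coalg_comul d) Z =
    A ◁ asc A A Z ∘ asc A (A ⊗ A) Z ∘
      ((asc A A A ∘ (coalg_comul d ⊠ idm A) ∘ coalg_comul d) ⊠ idm Z).
Proof.
rewrite !tail12E !tensrM -asc_pentagon -!compA; congr (_ ∘ _).
rewrite [_ ∘ (asc _ _ _ ∘ _)]compA -{1}tensm1 -ascN -!compA; congr (_ ∘ _).
by rewrite [_ ∘ (asc _ _ _ ⊠ _ ∘ _)]compA -(tensrM _ (csa A A A)) ascK tensm1 comp1m.
Qed.

Lemma tail_counitlE Z :
  tail10 (coalg_counit d) (A ⊗ Z) ∘ tail12 (coalg_comul d) Z =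
  (lun A ∘ (coalg_counit d ⊠ idm A) ∘ coalg_comul d) ⊠ idm Z.
Proof.
rewrite tail10E tail12E !tensrM -!compA [_ ∘ (asc _ _ _ ∘ _)]compA -{1}tensm1 -ascN.
by rewrite !compA; do 2 congr (_ ∘ _); casts; merge_casts; exact: idto_irr.
Qed.

Lemma tail_counitrE Z :
  A ◁ tail10 (coalg_counit d) Z ∘ tail12 (coalg_comul d) Z =
  (run A ∘ (idm A ⊠ coalg_counit d) ∘ coalg_comul d) ⊠ idm Z.
Proof.
rewrite tail10E tail12E !tensrM whiskM -!compA [A ◁ (_ ⊠ _) ∘ _]compA -ascN.
by rewrite !compA; do 2 congr (_ ∘ _); casts; merge_casts; exact: idto_irr.
Qed.

Hypothesis Hd : is_coalgebra d.

Lemma tail_comulA Z :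
  A ◁ tail12 (coalg_comul d) Z ∘ tail12 (coalg_comul d) Z =
  tail12 (coalg_comul d) (A ⊗ Z) ∘ tail12 (coalg_comul d) Z.
Proof. by rewrite tail_comulE tail_comulE' (coalgebra_comulA Hd). Qed.

Lemma tail_counitl Z :
  tail10 (coalg_counit d) (A ⊗ Z) ∘ tail12 (coalg_comul d) Z = idm _.
Proof. by rewrite tail_counitlE (coalgebra_counitl Hd) tensm1. Qed.

Lemma tail_counitr Z :
  A ◁ tail10 (coalg_counit d) Z ∘ tail12 (coalg_comul d) Z = idm _.
Proof. by rewrite tail_counitrE (coalgebra_counitr Hd) tensm1. Qed.

Lemma tail_cocomm Z : cocommutative d ->
  brT A A Z ∘ tail12 (coalg_comul d) Z = tail12 (coalg_comul d) Z.
Proof.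
move=> e; rewrite tail22E tail12E -!compA [csa _ _ _ ∘ _]compA ascK comp1m.
by rewrite -tensrM e.
Qed.
End Coalgebra.

Lemma tail12_comp A B D E (g : hom A (D ⊗ E)) (f : hom B A) Z :
  tail12 g Z ∘ (f ⊠ idm Z) = tail12 (g ∘ f) Z.
Proof. by rewrite !tail12E tensrM compA. Qed.

Lemma tail12_tail21 A B D E F (g : hom A (D ⊗ E)) (f : hom (B ⊗ F) A) Z :
  tail12 g Z ∘ tail21 f Z = tail22 (g ∘ f) Z.
Proof. by rewrite tail12E tail21E tail22E tensrM !compA. Qed.

End TailAxioms.

(** Makes an equation usable as a rewrite rule inside composites bracketed to the right. *)
Lemma comp_rw (C : category) (A B D : C) (a : hom B D) (b : hom A B) (r : hom A D) :
  a ∘ b = r -> forall E (x : hom E A), a ∘ (b ∘ x) = r ∘ x.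
Proof. by move=> <- E x; rewrite compA. Qed.

(** * Tensor products of coalgebras *)

Section TensorCoalgebra.
Variable C : strict_braided_category.
Variables (A B : C) (a : coalgebra_data A) (b : coalgebra_data B).
Implicit Types Z : C.
Notation brT A B Z := (tail22 (braid A B) Z).
Notation dA Z := (tail12 (coalg_comul a) Z).
Notation dB Z := (tail12 (coalg_comul b) Z).
Notation X := (A ⊗ B).

(* The coproduct of A ⊗ B, extended by Z and bracketed to the right. *)
Definition nabla Z : hom (A ⊗ (B ⊗ Z)) (A ⊗ (B ⊗ (A ⊗ (B ⊗ Z)))) :=
  locked (A ◁ brT A B (B ⊗ Z) ∘ (dA (B ⊗ (B ⊗ Z)) ∘ A ◁ dB Z)).

Lemma nablaE Z : nabla Z = A ◁ brT A B (B ⊗ Z) ∘ (dA (B ⊗ (B ⊗ Z)) ∘ A ◁ dB Z).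
Proof. by rewrite /nabla -lock. Qed.

Lemma nablaN Z Z' (h : hom Z Z') :
  nabla Z' ∘ A ◁ (B ◁ h) = A ◁ (B ◁ (A ◁ (B ◁ h))) ∘ nabla Z.
Proof.
rewrite !nablaE -!compA -[A ◁ dB _ ∘ _]whiskM (tail12N (coalg_comul b)) whiskM.
rewrite (comp_rw (tail12N (coalg_comul a) _)) -!compA.
by rewrite !compA -!whiskM tail22N.
Qed.

Lemma tail_tens_comul Z :
  tail12 (coalg_comul (tens_coalgebra a b)) Z =
  X ◁ csa A B Z ∘ (csa A B (A ⊗ (B ⊗ Z)) ∘ (nabla Z ∘ asc A B Z)).
Proof.
rewrite nablaE !tail12E tail22E /= /midswap.
rewrite (tens_split (coalg_comul a) (coalg_comul b)) !tensrM !whiskM !tensrA !tensrM !tensmidA.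
rewrite !whiskM; casts; merge_casts.
by match_casts.
Qed.

Lemma nabla_comulA Z : is_coalgebra a -> is_coalgebra b ->
  A ◁ (B ◁ nabla Z) ∘ nabla Z = nabla (A ⊗ (B ⊗ Z)) ∘ nabla Z.
Proof.
move=> Ha Hb.
(* [e3] and [e4] pull a braiding through a coproduct; the other equations slide morphisms past each
   other. Together they place all braidings after all coproducts, where coassociativity applies in
   each factor; [e7] then exchanges two disjoint crossings. *)
have e1 : A ◁ (B ◁ (A ◁ dB Z)) ∘ A ◁ brT A B (B ⊗ Z) =
    A ◁ brT A B (B ⊗ (B ⊗ Z)) ∘ A ◁ (A ◁ (B ◁ dB Z)).
  by rewrite -!whiskM tail22N.
have e2 : A ◁ (A ◁ (B ◁ dB Z)) ∘ dA (B ⊗ (B ⊗ Z)) =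
    dA (B ⊗ (B ⊗ (B ⊗ Z))) ∘ A ◁ (B ◁ dB Z).
  by rewrite tail12N.
have e3 : A ◁ (B ◁ dA (B ⊗ (B ⊗ Z))) ∘ A ◁ brT A B (B ⊗ (B ⊗ Z)) =
    A ◁ (brT A B (A ⊗ (B ⊗ (B ⊗ Z))) ∘ A ◁ brT A B (B ⊗ (B ⊗ Z))) ∘
    A ◁ dA (B ⊗ (B ⊗ (B ⊗ Z))).
  by rewrite -!whiskM -compA brT_comull.
have e4 : A ◁ dB (A ⊗ (B ⊗ Z)) ∘ A ◁ brT A B (B ⊗ Z) =
    A ◁ (B ◁ brT A B (B ⊗ Z) ∘ brT A B (B ⊗ (B ⊗ Z))) ∘ A ◁ (A ◁ dB (B ⊗ Z)).
  by rewrite -!whiskM -compA brT_comulr.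
have e5 : A ◁ (A ◁ dB (B ⊗ Z)) ∘ dA (B ⊗ (B ⊗ Z)) =
    dA (B ⊗ (B ⊗ (B ⊗ Z))) ∘ A ◁ dB (B ⊗ Z).
  by rewrite tail12N.
have e6 h : dA (B ⊗ (B ⊗ (A ⊗ (B ⊗ Z)))) ∘ A ◁ h =
    A ◁ (A ◁ h) ∘ dA (A ⊗ (B ⊗ (B ⊗ (B ⊗ Z)))).
  by rewrite tail12N.
have e7 : A ◁ brT A B (B ⊗ (A ⊗ (B ⊗ Z))) ∘ A ◁ (A ◁ (B ◁ brT A B (B ⊗ Z))) =
    A ◁ (B ◁ (A ◁ brT A B (B ⊗ Z))) ∘ A ◁ brT A B (A ⊗ (B ⊗ (B ⊗ Z))).
  by rewrite -!whiskM tail22N.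
rewrite !nablaE !whiskM -!compA (comp_rw e1) -compA (comp_rw e2) -compA (comp_rw e3) -!compA.
rewrite (comp_rw e4) -compA (comp_rw e5) -compA (comp_rw (e6 _)) -!compA.
rewrite (comp_rw (tail_comulA Ha _)) -whiskM (tail_comulA Hb) !whiskM -!compA.
by rewrite (comp_rw e7) -!compA.
Qed.

Lemma csa_whisk Z Z' (h : hom Z Z') :
  X ◁ h ∘ csa A B Z = csa A B Z' ∘ A ◁ (B ◁ h).
Proof. by rewrite csaN tensm1. Qed.

Lemma asc_whisk Z Z' (h : hom Z Z') :
  asc A B Z' ∘ X ◁ h = A ◁ (B ◁ h) ∘ asc A B Z.
Proof. by rewrite -ascN tensm1. Qed.

Lemma tail_tens_counit Z :
  tail10 (coalg_counit (tens_coalgebra a b)) Z =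
  tail10 (coalg_counit b) Z ∘ (tail10 (coalg_counit a) (B ⊗ Z) ∘ asc A B Z).
Proof.
rewrite !tail10E /= (tens_split (coalg_counit a) (coalg_counit b)) tens_swap.
rewrite !tensrM !tensrA !tensmidA tens_unitlE.
casts; merge_casts; rewrite [idto (eq_trans (tens_assoc A B Z) _)]idto_id compm1.
by match_casts.
Qed.

Lemma tail12_inj D E F (f g : hom D (E ⊗ F)) :
  tail12 f unit_ob = tail12 g (unit_ob : C) -> f = g.
Proof.
rewrite !tail12E => e; apply: tens_unit_inj.
by rewrite -[LHS]comp1m -[RHS]comp1m -ascK -!compA e.
Qed.

Lemma coalgebra_of_tails D (d : coalgebra_data (D : C)) :
  tail10 (coalg_counit d) (D ⊗ unit_ob) ∘ tail12 (coalg_comul d) unit_ob = idm _ ->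
  D ◁ tail10 (coalg_counit d) unit_ob ∘ tail12 (coalg_comul d) unit_ob = idm _ ->
  D ◁ tail12 (coalg_comul d) unit_ob ∘ tail12 (coalg_comul d) unit_ob =
    tail12 (coalg_comul d) (D ⊗ unit_ob) ∘ tail12 (coalg_comul d) unit_ob ->
  is_coalgebra d.
Proof.
rewrite tail_counitlE tail_counitrE tail_comulE tail_comulE' -!tensm1.
move=> /tens_unit_inj e1 /tens_unit_inj e2 e3; split=> //.
apply: tens_unit_inj; move: e3.
move/(f_equal (fun f => csa _ _ _ ∘ (D ◁ csa _ _ _ ∘ f))).
by rewrite -!compA ![D ◁ csa _ _ _ ∘ (D ◁ _ ∘ _)]compA -!whiskM !ascK tensm1 !comp1m
  ![csa _ _ _ ∘ (asc _ _ _ ∘ _)]compA !ascK !comp1m => ->.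
Qed.

Lemma nabla_counitl Z : is_coalgebra a -> is_coalgebra b ->
  tail10 (coalg_counit b) (A ⊗ (B ⊗ Z)) ∘
    tail10 (coalg_counit a) (B ⊗ (A ⊗ (B ⊗ Z))) ∘ nabla Z = idm _.
Proof.
move=> Ha Hb; rewrite nablaE -compA (comp_rw (tail10N _ _)) -compA (comp_rw (tail_counitl Ha _)) comp1m.
by rewrite (comp_rw (brT_counitr _ _ _)) -whiskM (tail_counitl Hb) tensm1.
Qed.

Lemma nabla_counitr Z : is_coalgebra a -> is_coalgebra b ->
  A ◁ (B ◁ (tail10 (coalg_counit b) Z ∘ tail10 (coalg_counit a) (B ⊗ Z))) ∘ nabla Z
  = idm _.
Proof.
move=> Ha Hb.
have e : B ◁ (tail10 (coalg_counit b) Z ∘ tail10 (coalg_counit a) (B ⊗ Z)) ∘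
    brT A B (B ⊗ Z) = tail10 (coalg_counit a) (B ⊗ Z) ∘ A ◁ (B ◁ tail10 (coalg_counit b) Z).
  by rewrite whiskM -compA brT_counitl tail10N.
rewrite nablaE !compA -whiskM e whiskM -!compA (comp_rw (esym (tail12N _ _))) -!compA.
rewrite (comp_rw (tail_counitr Ha _)) comp1m.
by rewrite -whiskM (tail_counitr Hb) tensm1.
Qed.

Lemma tens_coalgebra_axioms :
  is_coalgebra a -> is_coalgebra b -> is_coalgebra (tens_coalgebra a b).
Proof.
move=> Ha Hb; apply: coalgebra_of_tails.
- rewrite tail_tens_counit tail_tens_comul -!compA.
  rewrite (comp_rw (asc_whisk _)) -compA (comp_rw (csaK _ _ _)) comp1m.
  rewrite (comp_rw (tail10N _ _)) -compA (comp_rw (tail10N _ _)) -compA.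
  rewrite [tail10 _ _ ∘ (tail10 _ _ ∘ _)]compA (comp_rw (nabla_counitl _ Ha Hb)) comp1m.
  exact: ascK.
- rewrite tail_tens_counit tail_tens_comul.
  rewrite (comp_rw (esym (whiskM _ _ _))) -!compA csaK compm1.
  rewrite (comp_rw (csa_whisk _)) -compA (comp_rw (nabla_counitr _ Ha Hb)) comp1m.
  exact: ascK.
- rewrite !tail_tens_comul !whiskM -!compA.
  rewrite (comp_rw (asc_whisk _)) -compA (comp_rw (csaK _ _ _)) comp1m.
  rewrite (comp_rw (nablaN _)) -compA.
  rewrite (comp_rw (esym (nabla_comulA _ Ha Hb))).
  rewrite [X ◁ asc _ _ _ ∘ _](comp_rw (esym (whiskM _ _ _))) csaK tensm1 comp1m.
  rewrite -!compA [X ◁ nabla _ ∘ _](comp_rw (csa_whisk _)) -!compA.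
  rewrite (comp_rw (esym (whiskM _ _ _))) csa_whisk whiskM -!compA.
  by rewrite [X ◁ (A ◁ _) ∘ _](comp_rw (csa_whisk _)) -!compA.
Qed.

(** The hexagons in both variables resolve the crossing of A ⊗ B with itself into four crossings of
    single strands. *)
Lemma brT_tens Z :
  brT X X Z ∘ (X ◁ csa A B Z ∘ csa A B (A ⊗ (B ⊗ Z))) =
  X ◁ csa A B Z ∘ csa A B (A ⊗ (B ⊗ Z)) ∘
    (A ◁ brT A B (B ⊗ Z) ∘ (brT A A (B ⊗ (B ⊗ Z)) ∘
      A ◁ (A ◁ brT B B Z ∘ brT B A (B ⊗ Z)))).
Proof.
have el D : brT X D Z =
    D ◁ csa A B Z ∘ (brT A D (B ⊗ Z) ∘ A ◁ brT B D Z) ∘ asc A B (D ⊗ Z).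
  rewrite -brT_tensl !compA -whiskM ascK tensm1 comp1m -compA.
  by rewrite ascK compm1.
have er D Z' :
    brT D X Z' ∘ D ◁ csa A B Z' = csa A B (D ⊗ Z') ∘ (A ◁ brT D B Z' ∘ brT D A (B ⊗ Z')).
  by rewrite -brT_tensr !compA ascK comp1m.
rewrite el -!compA (comp_rw (asc_whisk _)) -!compA csaK compm1 -(whiskM A) er !whiskM.
by rewrite (comp_rw (er _ _)) -!compA.
Qed.

(** The c_{B,A} inside c_{X,X} meets the c_{A,B} inside the coproduct of A ⊗ B. The first hypothesis
    cancels this pair, and cocommutativity of the factors absorbs c_{A,A} and c_{B,B}. *)
Lemma tens_cocomm : braid B A ∘ braid A B = idm _ ->
  cocommutative a -> cocommutative b -> cocommutative (tens_coalgebra a b).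
Proof.
move=> sBA Ha Hb; apply: tail12_inj.
transitivity (brT X X unit_ob ∘ tail12 (coalg_comul (tens_coalgebra a b)) unit_ob).
  by rewrite tail22E !tail12E tensrM -!compA [csa _ _ _ ∘ _]compA ascK comp1m.
have sT Z : brT B A Z ∘ brT A B Z = idm _.
  rewrite !tail22E -!compA [csa B A _ ∘ _]compA ascK comp1m.
  by rewrite [_ ∘ (_ ∘ csa _ _ _)]compA -tensrM sBA tensm1 comp1m csaK.
rewrite tail_tens_comul [X ◁ _ ∘ _]compA (comp_rw (brT_tens _)) -!compA; do 2 congr (_ ∘ _).
rewrite nablaE !whiskM -!compA.
rewrite [A ◁ brT B A _ ∘ (A ◁ brT A B _ ∘ _)]compA -whiskM sT tensm1 comp1m.
rewrite (comp_rw (esym (tail12N _ _))) -!compA.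
rewrite [A ◁ brT B B _ ∘ _](comp_rw (esym (whiskM _ _ _))) (tail_cocomm _ Hb).
by rewrite (comp_rw (tail_cocomm _ Ha)).
Qed.

Definition proj1 : hom X A := run A ∘ A ◁ coalg_counit b.
Definition proj2 : hom X B := lun B ∘ (coalg_counit a ⊠ idm B).

Lemma tail_proj1 Z : proj1 ⊠ idm Z = A ◁ tail10 (coalg_counit b) Z ∘ asc A B Z.
Proof.
rewrite /proj1 tail10E tensrM tensmidA whiskM; casts; merge_casts.
by match_casts.
Qed.

Lemma tail_proj2 Z : proj2 ⊠ idm Z = tail10 (coalg_counit a) (B ⊗ Z) ∘ asc A B Z.
Proof.
rewrite /proj2 tail10E tensrM tensrA; casts; merge_casts.
rewrite [idto (eq_trans (tens_assoc A B Z) _)]idto_id compm1.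
by match_casts.
Qed.

Lemma tail12_tens D D' E E' F (f : hom D D') (g : hom E E') (h : hom F (D ⊗ E)) Z :
  tail12 ((f ⊠ g) ∘ h) Z = (f ⊠ idm (E' ⊗ Z)) ∘ (D ◁ (g ⊠ idm Z) ∘ tail12 h Z).
Proof.
by rewrite !tail12E tensrM !compA ascN [f ⊠ (_ ⊠ _)]tens_split.
Qed.

Lemma tail12_tens_comul D E (p : hom X D) (q : hom X E) Z
    (P : hom (A ⊗ (B ⊗ (E ⊗ Z))) (D ⊗ (E ⊗ Z))) (Q : hom (A ⊗ (B ⊗ Z)) (E ⊗ Z)) :
  p ⊠ idm (E ⊗ Z) = P ∘ asc A B (E ⊗ Z) -> q ⊠ idm Z = Q ∘ asc A B Z ->
  tail12 ((p ⊠ q) ∘ coalg_comul (tens_coalgebra a b)) Z =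
  P ∘ (A ◁ (B ◁ Q) ∘ (nabla Z ∘ asc A B Z)).
Proof.
move=> eP eQ; rewrite tail12_tens eP eQ tail_tens_comul.
rewrite !whiskM -!compA [X ◁ asc _ _ _ ∘ _](comp_rw (esym (whiskM _ _ _))) csaK tensm1 comp1m.
by rewrite (comp_rw (csa_whisk _)) -compA (comp_rw (csaK _ _ _)) comp1m.
Qed.

Lemma proj1_coalgmor : is_coalgebra a -> is_coalgebra b ->
  is_coalgebra_morphism (tens_coalgebra a b) a proj1.
Proof.
move=> Ha Hb; split.
  rewrite /proj1 compA -runN -compA -tens_split; congr (_ ∘ _); exact: idto_irr.
apply: tail12_inj; rewrite -tail12_comp tail_proj1.
rewrite (tail12_tens_comul (tail_proj1 _) (tail_proj1 _)) nablaE.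
have e1 : A ◁ (B ◁ (A ◁ tail10 (coalg_counit b) unit_ob)) ∘ A ◁ brT A B (B ⊗ unit_ob) =
    A ◁ brT A B unit_ob ∘ A ◁ (A ◁ (B ◁ tail10 (coalg_counit b) unit_ob)).
  by rewrite -!whiskM tail22N.
rewrite !compA; congr (_ ∘ _); rewrite -!compA (comp_rw e1) -!compA.
rewrite [A ◁ tail10 _ _ ∘ _](comp_rw (esym (whiskM _ _ _))) brT_counitr.
rewrite (comp_rw (esym (tail12N _ _))) -!compA -[A ◁ (B ◁ _) ∘ _]whiskM (tail_counitr Hb).
by rewrite tensm1 compm1 tail12N.
Qed.

Lemma proj2_coalgmor : is_coalgebra a -> is_coalgebra b ->
  is_coalgebra_morphism (tens_coalgebra a b) b proj2.
Proof.
move=> Ha Hb; split.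
  rewrite /proj2 compA -lunN -compA -tens_swap -tens_split; congr (_ ∘ _); exact: idto_irr.
apply: tail12_inj; rewrite -tail12_comp tail_proj2.
rewrite (tail12_tens_comul (tail_proj2 _) (tail_proj2 _)) nablaE.
rewrite !compA; congr (_ ∘ _); rewrite -!compA.
rewrite [A ◁ (B ◁ _) ∘ _](comp_rw (esym (whiskM _ _ _))) brT_counitl.
rewrite (comp_rw (tail_counitr Ha _)) comp1m.
by rewrite tail10N.
Qed.

(** The pair of generic points is the identity, so an equation that holds on it holds outright. *)
Lemma proj12 : is_coalgebra a -> is_coalgebra b ->
  (proj1 ⊠ proj2) ∘ coalg_comul (tens_coalgebra a b) = idm X.
Proof.
move=> Ha Hb; apply: tail12_inj.
rewrite (tail12_tens_comul (tail_proj1 _) (tail_proj2 _)) nablaE.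
rewrite [RHS]tail12E tensm1 compm1 -[RHS]comp1m !compA; congr (_ ∘ _); rewrite -!compA.
rewrite [A ◁ (B ◁ _) ∘ _](comp_rw (esym (whiskM _ _ _))) brT_counitl.
by rewrite (comp_rw (tail_counitr Ha _)) comp1m -whiskM (tail_counitl Hb) tensm1.
Qed.

End TensorCoalgebra.

(** * Symmetry of the braiding of a cocommutative Hopf algebra *)

Section Symmetry.
Variable C : strict_braided_category.
Variables (H : C) (a : algebra_data H) (d : coalgebra_data H) (s : hom H H).
Hypothesis HH : is_hopf_algebra a d s.
Implicit Types Z : C.
Notation brT A B Z := (tail22 (braid A B) Z).
Notation cc Z := (brT H H Z).
Notation mm Z := (tail21 (alg_mul a) Z).
Notation dd Z := (tail12 (coalg_comul d) Z).
Notation ee Z := (tail10 (coalg_counit d) Z).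
Notation uu Z := (tail01 (alg_unit a) Z).

Let Ha := hopf_is_algebra HH.
Let Hd := hopf_is_coalgebra HH.

Lemma tail_antipodel Z : mm Z ∘ (s ⊠ idm (H ⊗ Z)) ∘ dd Z = uu Z ∘ ee Z.
Proof.
rewrite tail21E tail12E tail10E tail01E -!compA [csa _ _ _ ∘ _]compA -tensm1 csaN.
rewrite -!compA [csa _ _ _ ∘ _]compA ascK comp1m.
rewrite [lnu _ ∘ _]compA lunK comp1m -!tensrM; congr (_ ⊠ _).
by rewrite compA (hopf_antipodel HH).
Qed.

Lemma tail_antipoder Z : mm Z ∘ H ◁ (s ⊠ idm Z) ∘ dd Z = uu Z ∘ ee Z.
Proof.
rewrite tail21E tail12E tail10E tail01E -!compA [csa _ _ _ ∘ _]compA csaN.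
rewrite -!compA [csa _ _ _ ∘ _]compA ascK comp1m.
rewrite [lnu _ ∘ _]compA lunK comp1m -!tensrM; congr (_ ⊠ _).
by rewrite compA (hopf_antipoder HH).
Qed.

Lemma tail_bialgebra Z :
  dd Z ∘ mm Z = mm (H ⊗ Z) ∘ (H ◁ (H ◁ mm Z) ∘ nabla d d Z).
Proof.
have e Z' : alg_mul a ⊠ idm Z' = mm Z' ∘ asc H H Z'.
  by rewrite tail21E -compA ascK compm1.
rewrite tail12_tail21 (coalgmor_comul (hopf_mul_coalgmor HH)).
transitivity (tail12 ((alg_mul a ⊠ alg_mul a) ∘ coalg_comul (tens_coalgebra d d)) Z
    ∘ csa H H Z); first by rewrite tail22E tail12E.
by rewrite (tail12_tens_comul d d (e _) (e _)) -!compA csaK compm1.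
Qed.

Section LeftCancel.
Variables Q Z : C.
(** Up to braidings, x ⊗ q goes to v ⊗ x_(1) w where v ⊗ w = u (x_(2) ⊗ q). Injectivity in u comes
    from repeating the construction with s x_(1) in place of x_(1). *)
Definition mul_left (u : hom (H ⊗ Q) (H ⊗ (H ⊗ Z))) : hom (H ⊗ Q) (H ⊗ (H ⊗ Z)) :=
  H ◁ mm Z ∘ (cc (H ⊗ Z) ∘ (H ◁ u ∘ dd Q)).

Lemma mul_left_inj u v : mul_left u = mul_left v -> u = v.
Proof.
pose inv w := H ◁ mm Z ∘ (cc (H ⊗ Z) ∘ (H ◁ w ∘ ((s ⊠ idm (H ⊗ Q)) ∘ dd Q))).
suff K w : inv (mul_left w) = w by move=> e; rewrite -(K u) e K.
have e1 : cc (H ⊗ Z) ∘ H ◁ (H ◁ mm Z) = H ◁ (H ◁ mm Z) ∘ cc (H ⊗ (H ⊗ Z)).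
  by rewrite tail22N.
have e2 : H ◁ mm (H ⊗ Z) ∘ (cc (H ⊗ (H ⊗ Z)) ∘ H ◁ cc (H ⊗ Z)) =
    cc (H ⊗ Z) ∘ mm (H ⊗ (H ⊗ Z)) by rewrite brT_mull.
rewrite /inv /mul_left !whiskM -!compA (comp_rw e1) -compA.
rewrite (comp_rw (esym (whiskM _ _ _))).
rewrite -(tail_mulA Ha) whiskM -compA.
rewrite [cc _ ∘ (H ◁ cc _ ∘ _)]compA (comp_rw e2) -!compA.
rewrite (comp_rw (tail21N _ _)) -!compA.
rewrite [H ◁ dd Q ∘ (_ ∘ _)]compA -tens_swap -!compA (tail_comulA Hd).
rewrite [_ ∘ (dd _ ∘ _)]compA [mm _ ∘ (_ ∘ _)]compA [mm _ ∘ (_ ∘ _)]compA tail_antipodel.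
rewrite -compA (tail_counitl Hd) compm1 -tail01N.
by rewrite (comp_rw (brT_unitl _ _ _)) (comp_rw (esym (whiskM _ _ _))) (tail_mul1l Ha) tensm1 comp1m.
Qed.
End LeftCancel.

(** Up to braidings, x ⊗ y goes to p y_(2) ⊗ q where p ⊗ q = u (x ⊗ y_(1)). The strand y_(2) belongs
    to the tail while u acts, so u has to be a family indexed by Z. It is recovered by multiplying
    with the antipode of a further factor of y. *)
Definition mul_right (u : forall Z, hom (H ⊗ (H ⊗ Z)) (H ⊗ (H ⊗ Z))) Z :=
  mm (H ⊗ Z) ∘ (H ◁ cc Z ∘ (u (H ⊗ Z) ∘ H ◁ dd Z)).

Lemma mul_rightK (u : forall Z, hom (H ⊗ (H ⊗ Z)) (H ⊗ (H ⊗ Z))) Z :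
  (forall Z Z' (h : hom Z Z'), u Z' ∘ H ◁ (H ◁ h) = H ◁ (H ◁ h) ∘ u Z) ->
  mm (H ⊗ Z) ∘ (H ◁ cc Z ∘ (mul_right u (H ⊗ Z) ∘ H ◁ (H ◁ (s ⊠ idm Z) ∘ dd Z))) = u Z.
Proof.
move=> uN; rewrite /mul_right.
have e1 : H ◁ cc Z ∘ mm (H ⊗ (H ⊗ Z)) = mm (H ⊗ (H ⊗ Z)) ∘ H ◁ (H ◁ cc Z).
  by rewrite -tail21N.
have e2 : H ◁ mm (H ⊗ Z) ∘ (H ◁ (H ◁ cc Z) ∘ H ◁ cc (H ⊗ Z)) =
    H ◁ cc Z ∘ H ◁ (H ◁ mm Z).
  by rewrite -!whiskM -brT_mulr.
rewrite -!compA (comp_rw e1) -compA (comp_rw (tail_mulA Ha _)) -compA.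
rewrite [H ◁ (H ◁ cc _) ∘ (_ ∘ _)]compA (comp_rw e2) -compA (comp_rw (esym (uN _ _ _))) -compA.
rewrite -!whiskM (comp_rw (tail12N _ _)) -compA -(tail_comulA Hd) (comp_rw (esym (whiskM _ _ _))).
rewrite [H ◁ _ ∘ (H ◁ dd Z ∘ _)](comp_rw (esym (whiskM _ _ _))) tail_antipoder.
rewrite (whiskM _ (uu Z)) -compA (tail_counitr Hd) compm1.
rewrite uN (comp_rw (esym (whiskM _ _ _))) brT_unitr.
by rewrite compA (tail_mul1r Ha) comp1m.
Qed.

Hypothesis Hc : cocommutative d.

(** Here cocommutativity is used on the output, as δ ∘ μ = c ∘ δ ∘ μ. Sliding this c through both
    products adds a second crossing of the middle strands x_(2) and y_(1), next to the one in the
    coproduct of H ⊗ H. *)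
Lemma mul_left_right_braid Z :
  mul_left (mul_right (fun Z => cc Z ∘ cc Z) Z) = dd Z ∘ mm Z.
Proof.
rewrite -(tail_cocomm _ Hc) -compA tail_bialgebra nablaE.
rewrite [cc Z ∘ _]compA brT_mull -!compA [H ◁ cc Z ∘ _](comp_rw (esym (whiskM _ _ _))).
rewrite brT_mulr tail12N /mul_left /mul_right !whiskM -!compA.
by do ?congr (_ ∘ _).
Qed.

Lemma mul_left_right_id Z : mul_left (mul_right (fun Z => idm _) Z) = dd Z ∘ mm Z.
Proof.
rewrite tail_bialgebra nablaE /mul_left /mul_right comp1m -(whiskM _ (cc Z)).
rewrite (tail_cocomm _ Hc) whiskM -!compA -tail12N [H ◁ mm _ ∘ _]compA.
have e1 : cc (H ⊗ Z) ∘ H ◁ mm (H ⊗ Z) =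
    mm (H ⊗ (H ⊗ Z)) ∘ (H ◁ cc (H ⊗ Z) ∘ cc (H ⊗ (H ⊗ Z))) by rewrite brT_mulr.
rewrite -!compA (comp_rw e1) -!compA (comp_rw (tail_cocomm _ Hc)) (comp_rw (esym (tail21N _ _))).
by rewrite -!compA.
Qed.

Lemma braid_sym : braid H H ∘ braid H H = idm _.
Proof.
have e Z : cc Z ∘ cc Z = idm _.
  (* [mul_rightK] recovers both c ∘ c and id by one formula from their images under [mul_right];
     these images agree because [mul_left] is injective. *)
  transitivity (mm (H ⊗ Z) ∘ (H ◁ cc Z ∘
      (mul_right (fun Z => idm _) (H ⊗ Z) ∘ H ◁ (H ◁ (s ⊠ idm Z) ∘ dd Z)))).
    rewrite -(@mul_rightK (fun Z => cc Z ∘ cc Z) Z).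
      by move=> *; rewrite -compA tail22N !compA tail22N.
    do 3 congr (_ ∘ _); apply: mul_left_inj.
    by rewrite mul_left_right_braid mul_left_right_id.
  by rewrite (@mul_rightK (fun Z => idm _)) // => *; rewrite comp1m compm1.
apply: tail12_inj.
have := e unit_ob.
rewrite !tail22E -!compA [csa _ _ _ ∘ _]compA ascK comp1m.
rewrite [_ ∘ (_ ∘ csa _ _ _)]compA -tensrM => e'.
by rewrite !tail12E -[LHS]compm1 -ascK compA -[X in X ∘ _]compA e' comp1m tensm1 compm1.
Qed.
End Symmetry.

(** * Points over a cocommutative coalgebra *)

Section Pairing.
Variable C : strict_braided_category.
Variables (X : C) (d : coalgebra_data X).
Hypothesis Hd : is_coalgebra d.
Implicit Types A B D E : C.

(** The pairing of generalised elements: on pairings casts rebracket, braidings permute and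
    coproducts duplicate, as for tuples of elements of sets. *)
Definition pairing A B (f : hom X A) (g : hom X B) : hom X (A ⊗ B) :=
  locked ((f ⊠ g) ∘ coalg_comul d).
Lemma pairingE A B (f : hom X A) (g : hom X B) :
  pairing f g = (f ⊠ g) ∘ coalg_comul d.
Proof. by rewrite /pairing -lock. Qed.

Local Notation "⟨ f , g ⟩" := (pairing f g).
Local Notation eps := (coalg_counit d).

Lemma tens_pairing A A' B B' (f' : hom A A') (g' : hom B B') f g :
  (f' ⊠ g') ∘ ⟨f, g⟩ = ⟨f' ∘ f, g' ∘ g⟩.
Proof. by rewrite !pairingE compA -tensmM. Qed.

Lemma asc_pairing A B D (f : hom X A) (g : hom X B) (h : hom X D) :
  asc A B D ∘ ⟨⟨f, g⟩, h⟩ = ⟨f, ⟨g, h⟩⟩.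
Proof.
transitivity ((f ⊠ (g ⊠ h)) ∘ (asc _ _ _ ∘ (coalg_comul d ⊠ idm X) ∘ coalg_comul d)).
  by rewrite !compA -ascN !pairingE -[h in LHS]compm1 tensmM !compA.
by rewrite (coalgebra_comulA Hd) compA -tensmM compm1 !pairingE.
Qed.

Lemma csa_pairing A B D (f : hom X A) (g : hom X B) (h : hom X D) :
  csa A B D ∘ ⟨f, ⟨g, h⟩⟩ = ⟨⟨f, g⟩, h⟩.
Proof. by rewrite -asc_pairing compA ascK comp1m. Qed.

Lemma lun_pairing A (f : hom X A) : lun A ∘ ⟨eps, f⟩ = f.
Proof.
by rewrite !pairingE tens_split tens_swap !compA lunN -!compA [lun _ ∘ _]compA
  (coalgebra_counitl Hd) compm1.
Qed.

Lemma run_pairing A (f : hom X A) : run A ∘ ⟨f, eps⟩ = f.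
Proof.
by rewrite !pairingE tens_split !compA runN -!compA [run _ ∘ _]compA
  (coalgebra_counitr Hd) compm1.
Qed.

Lemma lnu_pairing A (f : hom X A) : lnu A ∘ f = ⟨eps, f⟩.
Proof. by rewrite -[f in LHS]lun_pairing compA lunK comp1m. Qed.

Lemma rnu_pairing A (f : hom X A) : rnu A ∘ f = ⟨f, eps⟩.
Proof. by rewrite -[f in LHS]run_pairing compA /rnu /run idto_comp idto_id comp1m. Qed.

Lemma comul_pairing A (e : coalgebra_data (A : C)) f :
  is_coalgebra_morphism d e f -> coalg_comul e ∘ f = ⟨f, f⟩.
Proof. by rewrite pairingE; case. Qed.

Hypothesis Hc : cocommutative d.

Lemma braid_pairing A B (f : hom X A) (g : hom X B) : braid A B ∘ ⟨f, g⟩ = ⟨g, f⟩.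
Proof. by rewrite !pairingE compA braid_natural -compA Hc. Qed.

(** Over a cocommutative source a crossing and its inverse act alike, so [mu_op] gives the opposite
    product of points. *)
Lemma braid_inv_pairing A B (f : hom X A) (g : hom X B) : braid_inv B A ∘ ⟨f, g⟩ = ⟨g, f⟩.
Proof. by rewrite -(braid_pairing g f) compA braidK comp1m. Qed.

Lemma midswap_pairing A B D E (f : hom X A) (g : hom X B) (h : hom X D) (k : hom X E) :
  midswap A B D E ∘ ⟨⟨f, g⟩, ⟨h, k⟩⟩ = ⟨⟨f, h⟩, ⟨g, k⟩⟩.
Proof.
rewrite /midswap -!compA asc_pairing tens_pairing comp1m -!compA csa_pairing.
by rewrite tens_pairing braid_pairing comp1m asc_pairing csa_pairing.
Qed.

(** The middle swap exchanges two copies of X, which cocommutativity of X makes invisible; hence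
    test objects are cocommutative. *)
Lemma pairing_coalgmor A B (a : coalgebra_data (A : C)) (b : coalgebra_data B) f g :
  is_coalgebra_morphism d a f -> is_coalgebra_morphism d b g ->
  is_coalgebra_morphism d (tens_coalgebra a b) ⟨f, g⟩.
Proof.
move=> Hf Hg; split=> /=.
  rewrite -compA tens_pairing (coalgmor_counit Hf) (coalgmor_counit Hg).
  exact: lun_pairing.
rewrite -compA tens_pairing (comul_pairing Hf) (comul_pairing Hg).
by rewrite midswap_pairing [LHS]pairingE.
Qed.

Lemma counit_coalgmor : is_coalgebra_morphism d (unit_coalgebra C) eps.
Proof. by split; rewrite /= ?comp1m // lnu_pairing pairingE. Qed.

End Pairing.

Lemma coalgmor_comp (C : strict_braided_category) (A B D : C) (a : coalgebra_data A)
    (b : coalgebra_data B) (d : coalgebra_data D) (g : hom B D) (f : hom A B) :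
  is_coalgebra_morphism b d g -> is_coalgebra_morphism a b f ->
  is_coalgebra_morphism a d (g ∘ f).
Proof.
move=> [gc gd] [fc fd]; split; first by rewrite compA gc.
by rewrite compA gd -compA fd compA tensmM.
Qed.

Lemma coalgmor_id (C : strict_braided_category) (A : C) (a : coalgebra_data A) :
  is_coalgebra_morphism a a (idm A).
Proof. by split; rewrite ?tensm1 ?comp1m ?compm1. Qed.

Lemma comp_pairing (C : strict_braided_category) (X Y : C) (dX : coalgebra_data X)
    (dY : coalgebra_data Y) (A B : C) (f : hom X A) (g : hom X B) (h : hom Y X) :
  is_coalgebra_morphism dY dX h -> pairing dX f g ∘ h = pairing dY (f ∘ h) (g ∘ h).
Proof. by case=> _ e; rewrite !pairingE -compA e compA tensmM. Qed.

Record is_group (T : Type) (op : T -> T -> T) (e : T) (inv : T -> T) : Prop := IsGroup {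
  group_mulA : forall x y z, op x (op y z) = op (op x y) z;
  group_mul1l : forall x, op e x = x;
  group_mul1r : forall x, op x e = x;
  group_invl : forall x, op (inv x) x = e;
  group_invr : forall x, op x (inv x) = e }.

Section Points.
Variable C : strict_braided_category.
Implicit Types X A B D : C.

Definition point X A (dX : coalgebra_data X) (dA : coalgebra_data A) :=
  {f : hom X A | is_coalgebra_morphism dX dA f}.

Lemma point_eq X A (dX : coalgebra_data X) (dA : coalgebra_data A)
  (f g : point dX dA) : proj1_sig f = proj1_sig g -> f = g.
Proof. by case: f g => f Hf [g Hg] /= e; apply: subset_eq_compat. Qed.

Definition map_point X A B (dX : coalgebra_data X) (dA : coalgebra_data A)
    (dB : coalgebra_data B) (h : hom A B) (Hh : is_coalgebra_morphism dA dB h)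
    (f : point dX dA) : point dX dB :=
  exist _ (h ∘ proj1_sig f) (coalgmor_comp Hh (proj2_sig f)).

Section Operations.
Variables (X : C) (dX : coalgebra_data X).
Hypotheses (HX : is_coalgebra dX) (cX : cocommutative dX).

Definition pair_point A B (dA : coalgebra_data A) (dB : coalgebra_data B)
    (f : point dX dA) (g : point dX dB) : point dX (tens_coalgebra dA dB) :=
  exist _ (pairing dX (proj1_sig f) (proj1_sig g))
    (pairing_coalgmor HX cX (proj2_sig f) (proj2_sig g)).

Definition counit_point : point dX (unit_coalgebra C) := exist _ _ (counit_coalgmor HX).
End Operations.

Lemma pairing_proj A B (a : coalgebra_data (A : C)) (b : coalgebra_data (B : C)) :
  is_coalgebra a -> is_coalgebra b ->
  pairing (tens_coalgebra a b) (proj1 A b) (proj2 B a) = idm _.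
Proof. by rewrite pairingE; exact: proj12. Qed.

Section GenericPoints.
Variables (H : C) (d : coalgebra_data H).
Hypotheses (Hd : is_coalgebra d) (Hc : cocommutative d).
Hypothesis sym : braid H H ∘ braid H H = idm _.

Let HH := tens_coalgebra_axioms Hd Hd.
Let cHH := tens_cocomm sym Hc Hc.

Lemma eq_points2 D (f g : hom (H ⊗ H) D) :
  (forall X (dX : coalgebra_data X), is_coalgebra dX -> cocommutative dX ->
    forall x y : hom X H, is_coalgebra_morphism dX d x -> is_coalgebra_morphism dX d y ->
    f ∘ pairing dX x y = g ∘ pairing dX x y) -> f = g.
Proof.
move=> e; rewrite -[f]compm1 -[g]compm1 -(pairing_proj Hd Hd).
exact: (e _ _ HH cHH _ _ (proj1_coalgmor Hd Hd) (proj2_coalgmor Hd Hd)).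
Qed.

(** With [tens_cocomm] this makes H ⊗ (H ⊗ H) a cocommutative test object, the source of the generic
    triple. *)
Lemma braid_sym_tens : braid (H ⊗ H) H ∘ braid H (H ⊗ H) = idm _.
Proof.
rewrite braid_tensl braid_tensr.
rewrite -!compA [asc _ _ _ ∘ (csa _ _ _ ∘ _)]compA csaK comp1m.
rewrite [H ◁ _ ∘ (H ◁ _ ∘ _)]compA -whiskM sym tensm1 comp1m.
rewrite [csa _ _ _ ∘ (asc _ _ _ ∘ _)]compA ascK comp1m.
by rewrite [(_ ⊠ _) ∘ (_ ∘ _)]compA -tensrM sym tensm1 comp1m csaK.
Qed.

Lemma eq_points3 D (f g : hom (H ⊗ (H ⊗ H)) D) :
  (forall X (dX : coalgebra_data X), is_coalgebra dX -> cocommutative dX ->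
    forall x y z : hom X H, is_coalgebra_morphism dX d x ->
    is_coalgebra_morphism dX d y -> is_coalgebra_morphism dX d z ->
    f ∘ pairing dX x (pairing dX y z) = g ∘ pairing dX x (pairing dX y z)) -> f = g.
Proof.
move=> e; have p2 := proj2_coalgmor Hd HH.
rewrite -[f]compm1 -[g]compm1 -(pairing_proj Hd HH).
rewrite -[X in pairing _ _ X]comp1m -(pairing_proj Hd Hd).
rewrite (comp_pairing _ _ p2).
apply: e (tens_coalgebra_axioms Hd HH) (tens_cocomm braid_sym_tens Hc cHH) _ _ _ _ _ _.
- exact: proj1_coalgmor.
- exact: coalgmor_comp (proj1_coalgmor Hd Hd) p2.
- exact: coalgmor_comp (proj2_coalgmor Hd Hd) p2.
Qed.

End GenericPoints.
End Points.

(** * Convolution, and the antipode as a coalgebra morphism *)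

Section Convolution.
Variables (C : strict_braided_category) (X : C) (dX : coalgebra_data X).
Hypothesis HX : is_coalgebra dX.
Variables (A : C) (a : algebra_data A).
Hypothesis Ha : is_algebra a.

Definition conv (f g : hom X A) : hom X A := alg_mul a ∘ pairing dX f g.
Definition conv_unit : hom X A := alg_unit a ∘ coalg_counit dX.

Lemma convA f g h : conv f (conv g h) = conv (conv f g) h.
Proof.
rewrite /conv -[f in LHS]comp1m -tens_pairing -[h in RHS]comp1m -tens_pairing !compA.
by rewrite (algebra_mulA Ha) -[RHS]compA (asc_pairing HX).
Qed.

Lemma conv1l f : conv conv_unit f = f.
Proof.
rewrite /conv /conv_unit -[f in LHS]comp1m -tens_pairing compA (algebra_mul1l Ha).
exact: lun_pairing.
Qed.

Lemma conv1r f : conv f conv_unit = f.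
Proof.
rewrite /conv /conv_unit -[f in LHS]comp1m -tens_pairing compA (algebra_mul1r Ha).
exact: run_pairing.
Qed.

Lemma conv_inv_uniq f g h : conv g f = conv_unit -> conv f h = conv_unit -> g = h.
Proof. by move=> e1 e2; rewrite -[g]conv1r -e2 convA e1 conv1l. Qed.

End Convolution.

Section Antipode.
Variables (C : strict_braided_category) (A : C).
Variables (a : algebra_data A) (d : coalgebra_data A) (s : hom A A).
Hypothesis HA : is_hopf_algebra a d s.
Let Ha := hopf_is_algebra HA.
Let Hd := hopf_is_coalgebra HA.

Section AtPoint.
Variables (X : C) (dX : coalgebra_data X) (x : hom X A).
Hypotheses (HX : is_coalgebra dX) (Hx : is_coalgebra_morphism dX d x).

Lemma conv_antipodel : conv dX a (s ∘ x) x = conv_unit dX a.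
Proof.
rewrite /conv /conv_unit -[x in pairing _ _ x]comp1m -tens_pairing.
rewrite -(comul_pairing Hx) !compA (hopf_antipodel HA) -!compA.
by rewrite (coalgmor_counit Hx).
Qed.

Lemma conv_antipoder : conv dX a x (s ∘ x) = conv_unit dX a.
Proof.
rewrite /conv /conv_unit -[x in pairing _ x _]comp1m -tens_pairing.
rewrite -(comul_pairing Hx) !compA (hopf_antipoder HA) -!compA.
by rewrite (coalgmor_counit Hx).
Qed.
End AtPoint.

Hypothesis Hc : cocommutative d.

Let dAA := tens_coalgebra d d.
Let HAA : is_coalgebra dAA := tens_coalgebra_axioms Hd Hd.

Lemma cocommutative_tens : cocommutative dAA.
Proof. exact: tens_cocomm (braid_sym HA Hc) Hc Hc. Qed.

(* The shear map [(x, y) |-> (x, x y)] is a bijective morphism of coalgebras, so its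
   inverse [(x, y) |-> (x, s x y)] is one, and [s] is a component of the inverse. *)
Lemma antipode_coalgmor : is_coalgebra_morphism d d s.
Proof.
pose shear (t : hom A A) :=
  idm A ⊠ (alg_mul a ∘ (t ⊠ idm A)) ∘ (asc A A A ∘ (coalg_comul d ⊠ idm A)).
have shearE t X dX (x y : hom X A) : is_coalgebra dX -> is_coalgebra_morphism dX d x ->
    shear t ∘ pairing dX x y = pairing dX x (conv dX a (t ∘ x) y).
  move=> HX Hx; rewrite /shear -!compA tens_pairing (comul_pairing Hx) asc_pairing //.
  by rewrite tens_pairing -compA tens_pairing !comp1m.
have p1 := proj1_coalgmor Hd Hd; have p2 := proj2_coalgmor Hd Hd.
have e1 : shear (idm A) ∘ shear s = idm _.
  rewrite -[LHS]compm1 -(pairing_proj Hd Hd) -compA !shearE //.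
  by rewrite comp1m convA // conv_antipoder // conv1l.
have e2 : shear s ∘ shear (idm A) = idm _.
  rewrite -[LHS]compm1 -(pairing_proj Hd Hd) -compA !shearE //.
  by rewrite comp1m convA // conv_antipodel // conv1l.
have H1 : is_coalgebra_morphism dAA dAA (shear (idm A)).
  rewrite -[shear _]compm1 -(pairing_proj Hd Hd) shearE // comp1m.
  apply: pairing_coalgmor => //; first exact: cocommutative_tens.
  rewrite /conv (pairing_proj Hd Hd) compm1.
  exact: hopf_mul_coalgmor HA.
(* A two-sided inverse of a coalgebra morphism is a coalgebra morphism. *)
have H2 : is_coalgebra_morphism dAA dAA (shear s).
  case: H1 => c1 d1; split.
    by rewrite -c1 -compA e1 compm1.
  rewrite -[LHS]comp1m -tensm1 -e2 tensmM -compA [X in _ ∘ X]compA -d1.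
  by rewrite -[X in _ ∘ X]compA e1 compm1.
have Hu : is_coalgebra_morphism d d (conv_unit d a).
  exact: coalgmor_comp (hopf_unit_coalgmor HA) (counit_coalgmor Hd).
(* [shear s] maps (x, 1) to (x, s x); its second component is s x. *)
have -> : s = proj2 A d ∘ (shear s ∘ pairing d (idm A) (conv_unit d a)).
  rewrite shearE ?conv1r // ?compm1; first exact: coalgmor_id.
  by rewrite /proj2 -compA tens_pairing compm1 comp1m lun_pairing.
apply: coalgmor_comp p2 (coalgmor_comp H2 _).
by apply: pairing_coalgmor => //; exact: coalgmor_id.
Qed.

End Antipode.

(** Both composites are convolution inverses of f: the left one since f is an algebra morphism, the
    right one since it is a coalgebra morphism. *)
Lemma hopf_morphism_antipode (C : strict_braided_category) (A B : hopf_algebra C)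
  (f : hom (A : C) B) : is_hopf_morphism A B f -> f ∘ antipode A = antipode B ∘ f.
Proof.
move=> [[fu fm] Hf]; have HA := hopf_axioms A; have HB := hopf_axioms B.
apply: (conv_inv_uniq (hopf_is_coalgebra HA) (hopf_is_algebra HB) (f := f)).
  rewrite /conv -[f in pairing _ _ f]compm1 -tens_pairing compA -fm -compA.
  rewrite -[X in pairing _ _ X](compm1 (idm _)).
  have := conv_antipodel HA (coalgmor_id (hopf_coalg A)).
  rewrite /conv compm1 comp1m => ->.
  by rewrite /conv_unit compA fu.
exact: (conv_antipoder HB Hf).
Qed.

Section PointGroup.
Variables (C : strict_braided_category) (H : C).
Variables (a : algebra_data H) (d : coalgebra_data H) (s : hom H H).

Definition mul_point (X : C) (dX : coalgebra_data X) (HX : is_coalgebra dX)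
  (cX : cocommutative dX) (m : hom (H ⊗ H) H)
  (Hm : is_coalgebra_morphism (tens_coalgebra d d) d m) (x y : point dX d) :
  point dX d := map_point Hm (pair_point HX cX x y).

Definition unit_point (X : C) (dX : coalgebra_data X) (HX : is_coalgebra dX)
  (u : hom unit_ob H) (Hu : is_coalgebra_morphism (unit_coalgebra C) d u) :
  point dX d := map_point Hu (counit_point HX).

Lemma hopf_point_group (HH : is_hopf_algebra a d s) (Hs : is_coalgebra_morphism d d s)
  (X : C) (dX : coalgebra_data X) (HX : is_coalgebra dX) (cX : cocommutative dX) :
  is_group (mul_point HX cX (hopf_mul_coalgmor HH))
    (unit_point HX (hopf_unit_coalgmor HH)) (map_point Hs).
Proof.
have Ha := hopf_is_algebra HH.
split.
- by move=> x y z; apply: point_eq; exact: (convA HX Ha).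
- by move=> x; apply: point_eq; exact: (conv1l HX Ha).
- by move=> x; apply: point_eq; exact: (conv1r HX Ha).
- by move=> [x Hx]; apply: point_eq; exact: (conv_antipodel HH Hx).
- by move=> [x Hx]; apply: point_eq; exact: (conv_antipoder HH Hx).
Qed.
End PointGroup.

(** * Skew braces *)

Section GroupTheory.
Variables (T : Type) (op : T -> T -> T) (e : T) (inv : T -> T).
Hypothesis G : is_group op e inv.

Lemma group_mulKV x y : op x (op (inv x) y) = y.
Proof. by rewrite (group_mulA G) (group_invr G) (group_mul1l G). Qed.

Lemma group_mulK x y : op (inv x) (op x y) = y.
Proof. by rewrite (group_mulA G) (group_invl G) (group_mul1l G). Qed.

Lemma group_inv_uniq x y : op x y = e -> inv x = y.
Proof. by move=> exy; rewrite -[LHS](group_mul1r G) -exy group_mulK. Qed.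

Lemma group_invK x : inv (inv x) = x.
Proof. exact: group_inv_uniq (group_invl G x). Qed.

Lemma group_inv1 : inv e = e.
Proof. exact: group_inv_uniq (group_mul1l G e). Qed.

Lemma group_invM x y : inv (op x y) = op (inv y) (inv x).
Proof.
by apply: group_inv_uniq; rewrite -(group_mulA G) group_mulKV (group_invr G).
Qed.

End GroupTheory.

Section SkewBrace.
Variables (T : Type) (add mul : T -> T -> T) (zero one : T) (opp inv : T -> T).
Hypotheses (Ga : is_group add zero opp) (Gm : is_group mul one inv).
Hypothesis brace : forall x y z,
  mul x (add y z) = add (mul x y) (add (opp x) (mul x z)).

Let gamma x y := add (opp x) (mul x y).
(** [gamma] is the lambda map of the skew brace, a left action of (T, mul) on (T, add). Passing to
    [inv x] reverses the order in [brace_actA] and yields [brace_mul_act], which recovers [add] from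
    [mul] and the action. *)
Definition brace_act x y := gamma (inv x) y.

Lemma brace_mul0 x : mul x zero = x.
Proof.
(* The third argument is [one], written so that [mul x] of it cancels to x; the term [add (opp x) x]
   then disappears. *)
have := brace x zero (mul (inv x) x).
rewrite (group_mul1l Ga) (group_mulKV Gm) (group_invl Ga) (group_mul1r Ga).
exact: esym.
Qed.

Lemma brace_zero : zero = one.
Proof. by rewrite -(brace_mul0 one) (group_mul1l Gm). Qed.

Let mul_gamma x y : mul x y = add x (gamma x y).
Proof. by rewrite /gamma (group_mulKV Ga). Qed.

Let gammaD x y z : gamma x (add y z) = add (gamma x y) (gamma x z).
Proof. by rewrite /gamma brace !(group_mulA Ga). Qed.

Let gamma_opp x y : gamma x (opp y) = add (opp (mul x y)) x.
Proof.
have := brace x y (opp y); rewrite (group_invr Ga) brace_mul0 -/(gamma x (opp y)) => e.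
by rewrite [X in _ = add _ X]e (group_mulK Ga).
Qed.

(** Additivity splits gamma x (opp y + y z), with [add] written + and [mul] as juxtaposition; by
    [gamma_opp] the first part is opp (x y) + x, whose x cancels the opp x of the second part. *)
Let gammaM x y z : gamma (mul x y) z = gamma x (gamma y z).
Proof.
rewrite {3}/gamma gammaD gamma_opp /gamma -!(group_mulA Ga) (group_mulKV Ga).
by rewrite (group_mulA Gm).
Qed.

Let gamma1 x : gamma one x = x.
Proof. by rewrite /gamma (group_mul1l Gm) -brace_zero (group_inv1 Ga) (group_mul1l Ga). Qed.

Lemma brace_act1 x : brace_act one x = x.
Proof. by rewrite /brace_act (group_inv1 Gm) gamma1. Qed.

Lemma brace_act_one x : brace_act x one = one.
Proof. by rewrite /brace_act /gamma (group_mul1r Gm) (group_invl Ga) brace_zero. Qed.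

Lemma brace_actA x y z : brace_act x (brace_act y z) = brace_act (mul y x) z.
Proof. by rewrite /brace_act -gammaM (group_invM Gm). Qed.

Lemma brace_mul_act x y : mul x (brace_act x y) = add x y.
Proof. by rewrite mul_gamma /brace_act -gammaM (group_invr Gm) gamma1. Qed.

Lemma brace_actD x y z :
  brace_act x (add y z) = add (brace_act x y) (brace_act x z).
Proof. exact: gammaD. Qed.

Lemma brace_act_opp x : brace_act x (opp x) = inv x.
Proof.
rewrite /brace_act gamma_opp (group_invl Gm) -brace_zero (group_inv1 Ga).
exact: group_mul1l Ga _.
Qed.

End SkewBrace.

(** * The skew brace defined by a group with an opposite action *)

Section OppositeTriple.
Variables (T : Type) (mul : T -> T -> T) (one : T) (inv : T -> T).
Variables (act : T -> T -> T) (opp : T -> T).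
Hypothesis Gm : is_group mul one inv.
Let add x y := mul x (act x y).
Hypotheses (act1 : forall x, act one x = x) (act_one : forall x, act x one = one).
Hypothesis actA : forall x y z, act x (act y z) = act (mul y x) z.
Hypothesis actD : forall x y z, act x (add y z) = add (act x y) (act x z).
Hypotheses (oppK : forall x, opp (opp x) = x) (act_opp : forall x, act x (opp x) = inv x).

(** For associativity, [actD] distributes [act x], and the reversed order in [actA] fuses act (act x
    y) (act x z) into act (add x y) z. [act_opp] gives the right inverse law; at [opp x] it is the
    left inverse law, because [opp] is an involution. *)
Lemma triple_group : is_group add one opp.
Proof.
have addN x : add x (opp x) = one by rewrite /add act_opp (group_invr Gm).
split=> //.
- by move=> x y z; rewrite -[LHS]/(mul x (act x (add y z))) actD /add -actA (group_mulA Gm).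
- by move=> x; rewrite /add act1 (group_mul1l Gm).
- by move=> x; rewrite /add act_one (group_mul1r Gm).
- by move=> x; rewrite -{2}(oppK x) addN.
Qed.

Lemma triple_add_act x y : add x (act (inv x) y) = mul x y.
Proof. by rewrite /add actA (group_invl Gm) act1. Qed.

Lemma triple_act x y : act (inv x) y = add (opp x) (mul x y).
Proof. by rewrite -triple_add_act (group_mulK triple_group). Qed.

(** Left multiplication by x is [add x] after [act (inv x)], and the latter is additive. *)
Lemma triple_brace x y z :
  mul x (add y z) = add (mul x y) (add (opp x) (mul x z)).
Proof.
by rewrite -triple_act -[LHS]triple_add_act actD (group_mulA triple_group) triple_add_act.
Qed.

End OppositeTriple.

(** * Hopf braces and opposite brace triples *)

(** Evaluates a diagram on a tuple. Reassociation to the right brings each structural map next to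
    the pairing it acts on; coproducts are handled between calls, by [comul_pairing] for the point
    concerned. *)
Ltac cartesian HX cX :=
  rewrite ?(=^~ compA, comp1m, compm1, tens_pairing, asc_pairing HX, csa_pairing HX,
    braid_pairing cX).

Section UnitSources.
Variables (C : strict_braided_category) (A D : C) (d : coalgebra_data A).
Hypothesis Hd : is_coalgebra d.

(** The pairing is the invertible cast [lnu A], so laws in one variable are tested on the identity
    point of A. *)
Lemma eq_unitl (f g : hom (unit_ob ⊗ A) D) :
  f ∘ pairing d (coalg_counit d) (idm A) = g ∘ pairing d (coalg_counit d) (idm A) -> f = g.
Proof.
rewrite -lnu_pairing // compm1 => e.
by rewrite -[f]compm1 -[g]compm1 -lunK !compA e.
Qed.

Lemma eq_unitr (f g : hom (A ⊗ unit_ob) D) :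
  f ∘ pairing d (idm A) (coalg_counit d) = g ∘ pairing d (idm A) (coalg_counit d) -> f = g.
Proof.
rewrite -rnu_pairing // compm1 => e.
have runK : rnu A ∘ run A = idm _ by rewrite /rnu /run idto_comp idto_id.
by rewrite -[f]compm1 -[g]compm1 -runK !compA e.
Qed.
End UnitSources.

Section BraceToTriple.
Variables (C : strict_braided_category) (H : hopf_brace C).
Notation d := (hb_coalg H).
Notation mu1 := (alg_mul (hb_alg1 H)).
Notation mu2 := (alg_mul (hb_alg2 H)).
Notation s1 := (hb_antipode1 H).
Notation s2 := (hb_antipode2 H).
Notation H1 := (hb_hopf1 H).
Notation H2 := (hb_hopf2 H).

Definition brace_gamma : hom (hb_ob H ⊗ hb_ob H) (hb_ob H) :=
  mu1 ∘ (s1 ⊠ mu2) ∘ asc _ _ _ ∘ (coalg_comul d ⊠ idm _).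

Definition brace_action : hom (hb_ob H ⊗ hb_ob H) (hb_ob H) :=
  locked (brace_gamma ∘ (s2 ⊠ idm _)).

Lemma brace_actionE : brace_action = brace_gamma ∘ (s2 ⊠ idm _).
Proof. by rewrite /brace_action -lock. Qed.

Lemma brace_gamma_pairing X (dX : coalgebra_data X) (x y : hom X (hb_ob H)) :
  is_coalgebra dX -> is_coalgebra_morphism dX d x ->
  brace_gamma ∘ pairing dX x y = mu1 ∘ pairing dX (s1 ∘ x) (mu2 ∘ pairing dX x y).
Proof.
move=> HX Hx; rewrite /brace_gamma -!compA tens_pairing (comul_pairing Hx) comp1m.
by rewrite asc_pairing // tens_pairing.
Qed.

Hypothesis Hc : cocommutative d.
Let Hs1 : is_coalgebra_morphism d d s1 := antipode_coalgmor H1 Hc.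
Let Hs2 : is_coalgebra_morphism d d s2 := antipode_coalgmor H2 Hc.
Let Hd := hopf_is_coalgebra H1.
Let sym := braid_sym H1 Hc.

Section AtPoints.
Variables (X : C) (dX : coalgebra_data X).
Hypotheses (HX : is_coalgebra dX) (cX : cocommutative dX).
Let add := mul_point HX cX (hopf_mul_coalgmor H1).
Let mul := mul_point HX cX (hopf_mul_coalgmor H2).
Let opp := map_point (dX := dX) Hs1.
Let inv := map_point (dX := dX) Hs2.
Let act := brace_act add mul opp inv.

Lemma brace_points x y z : mul x (add y z) = add (mul x y) (add (opp x) (mul x z)).
Proof.
case: x y z => [x Hx] [y Hy] [z Hz]; apply: point_eq => /=.
have := f_equal (fun f => f ∘ pairing dX x (pairing dX y z)) (hb_compat H).
by cartesian HX cX; rewrite (comul_pairing Hx); cartesian HX cX;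
  rewrite (comul_pairing Hx); cartesian HX cX.
Qed.

Lemma brace_action_point (x y : point dX d) :
  brace_action ∘ pairing dX (proj1_sig x) (proj1_sig y) = proj1_sig (act x y).
Proof.
case: x y => [x Hx] [y Hy]; rewrite brace_actionE -compA tens_pairing comp1m.
by rewrite brace_gamma_pairing //; exact: coalgmor_comp Hs2 Hx.
Qed.

End AtPoints.

Notation pt x Hx := (exist _ x Hx : point _ d).

(** At the identity point, zero = one reads η_1 ∘ ε = η_2 ∘ ε; composing with η_1 removes ε. A
    triple keeps only η_2, so the round trip depends on this. *)
Lemma brace_eta : alg_unit (hb_alg1 H) = alg_unit (hb_alg2 H).
Proof.
have := brace_zero (hopf_point_group H1 Hs1 Hd Hc) (hopf_point_group H2 Hs2 Hd Hc)
  (brace_points Hd Hc).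
move/(f_equal (fun f => proj1_sig f ∘ alg_unit (hb_alg1 H))) => /=.
by rewrite -!compA (coalgmor_counit (hopf_unit_coalgmor H1)) !compm1.
Qed.

(** The value of [brace_act] at the generic pair is a point, and its underlying morphism is
    [brace_action]. *)
Lemma brace_action_coalgmor : is_coalgebra_morphism (tens_coalgebra d d) d brace_action.
Proof.
have HHH := tens_coalgebra_axioms Hd Hd; have cHH := cocommutative_tens H1 Hc.
have := brace_action_point HHH cHH (pt _ (proj1_coalgmor Hd Hd)) (pt _ (proj2_coalgmor Hd Hd)).
by case: (brace_act _ _ _ _ _ _) => m Hm; rewrite /= (pairing_proj Hd Hd) compm1 => ->.
Qed.

(** It turns axiom (v) into additivity of the action and recovers the product of H_1 in the round
    trip. *)
Lemma brace_mu_tilde : mu_tilde (A := hb_snd H) brace_action = mu1.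
Proof.
apply: (eq_points2 Hd Hc sym) => X dX HX cX x y Hx Hy.
rewrite /mu_tilde /mu /delta /= -!compA tens_pairing (comul_pairing Hx) asc_pairing // comp1m.
rewrite tens_pairing comp1m (brace_action_point HX cX (pt _ Hx) (pt _ Hy)).
exact: (f_equal (@proj1_sig _ _) (brace_mul_act (hopf_point_group H1 Hs1 HX cX)
  (hopf_point_group H2 Hs2 HX cX) (brace_points HX cX) (pt _ Hx) (pt _ Hy))).
Qed.

Lemma brace_is_triple :
  is_opposite_brace_triple (A := hb_snd H) brace_action s1.
Proof.
have Gm X dX (HX : is_coalgebra dX) (cX : cocommutative dX) :=
  @hopf_point_group _ _ _ _ _ H2 Hs2 X dX HX cX.
have Ga X dX (HX : is_coalgebra dX) (cX : cocommutative dX) :=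
  @hopf_point_group _ _ _ _ _ H1 Hs1 X dX HX cX.
have Bp X dX (HX : is_coalgebra dX) (cX : cocommutative dX) := @brace_points X dX HX cX.
split.
- exact: brace_action_coalgmor.
- apply: (eq_unitl Hd); rewrite -compA tens_pairing comp1m lun_pairing //.
  have := brace_act1 (Ga _ _ Hd Hc) (Gm _ _ Hd Hc) (Bp _ _ Hd Hc) (pt _ (coalgmor_id d)).
  by move/(f_equal (@proj1_sig _ _)); rewrite -brace_action_point.
- apply: (eq_unitr Hd); rewrite /epsilon /eta /= -!compA !tens_pairing comp1m !compm1.
  rewrite lun_pairing //.
  have := brace_act_one (Ga _ _ Hd Hc) (Gm _ _ Hd Hc) (Bp _ _ Hd Hc) (pt _ (coalgmor_id d)).
  by move/(f_equal (@proj1_sig _ _)); rewrite -brace_action_point.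
- apply: (eq_points3 Hd Hc sym) => X dX HX cX x y z Hx Hy Hz.
  rewrite -!compA csa_pairing // !tens_pairing !comp1m /mu_op -compA braid_inv_pairing //.
  have := brace_actA (Ga _ _ HX cX) (Gm _ _ HX cX) (Bp _ _ HX cX) (pt _ Hx) (pt _ Hy) (pt _ Hz).
  by move/(f_equal (@proj1_sig _ _)); rewrite -!brace_action_point.
- rewrite brace_mu_tilde.
  apply: (eq_points3 Hd Hc sym) => X dX HX cX x y z Hx Hy Hz.
  cartesian HX cX; rewrite (comul_pairing Hx); cartesian HX cX.
  rewrite (brace_action_point HX cX (pt _ Hx) (pt _ Hy)).
  rewrite (brace_action_point HX cX (pt _ Hx) (pt _ Hz)).
  have := brace_actD (map_point Hs2) (Ga _ _ HX cX) (Bp _ _ HX cX) (pt _ Hx) (pt _ Hy) (pt _ Hz).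
  by move/(f_equal (@proj1_sig _ _)); rewrite -brace_action_point.
- exact: Hs1.
- have := group_invK (Ga _ _ Hd Hc) (pt _ (coalgmor_id d)).
  by move/(f_equal (@proj1_sig _ _)); rewrite /= compm1.
- have := brace_act_opp (Ga _ _ Hd Hc) (Gm _ _ Hd Hc) (Bp _ _ Hd Hc) (pt _ (coalgmor_id d)).
  move/(f_equal (@proj1_sig _ _)); rewrite -brace_action_point /= !compm1 => <-.
  by rewrite pairingE compA.
Qed.

End BraceToTriple.

(** Converse of [hopf_point_group]: unit and antipode laws are the group laws at the identity point,
    associativity is that of the generic triple. *)
Lemma hopf_of_point_groups (C : strict_braided_category) (H : C) (d : coalgebra_data H)
    (a : algebra_data H) (s : hom H H)
    (Hd : is_coalgebra d) (Hc : cocommutative d)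
    (sym : braid H H ∘ braid H H = idm _)
    (Hu : is_coalgebra_morphism (unit_coalgebra C) d (alg_unit a))
    (Hm : is_coalgebra_morphism (tens_coalgebra d d) d (alg_mul a))
    (Hs : is_coalgebra_morphism d d s) :
  (forall X (dX : coalgebra_data X) (HX : is_coalgebra dX) (cX : cocommutative dX),
    is_group (mul_point HX cX Hm) (unit_point HX Hu) (map_point Hs)) ->
  is_hopf_algebra a d s.
Proof.
move=> G; pose i : point d d := exist _ _ (coalgmor_id d).
split=> //.
- split.
  + apply: (eq_unitl Hd); rewrite -compA tens_pairing comp1m lun_pairing //.
    exact: (f_equal (@proj1_sig _ _) (group_mul1l (G _ _ Hd Hc) i)).
  + apply: (eq_unitr Hd); rewrite -compA tens_pairing comp1m run_pairing //.
    exact: (f_equal (@proj1_sig _ _) (group_mul1r (G _ _ Hd Hc) i)).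
  + rewrite -[LHS]compm1 -ascK compA; congr (_ ∘ _).
    apply: (eq_points3 Hd Hc sym) => X dX HX cX x y z Hx Hy Hz.
    rewrite -!compA csa_pairing // !tens_pairing !comp1m.
    symmetry; exact: (f_equal (@proj1_sig _ _)
      (group_mulA (G _ _ HX cX) (exist _ x Hx) (exist _ y Hy) (exist _ z Hz))).
- have := f_equal (@proj1_sig _ _) (group_invl (G _ _ Hd Hc) i).
  by rewrite /= compm1 pairingE compA.
- have := f_equal (@proj1_sig _ _) (group_invr (G _ _ Hd Hc) i).
  by rewrite /= compm1 pairingE compA.
Qed.

Section TripleToBrace.
Variables (C : strict_braided_category) (A : hopf_algebra C).
Variables (m : hom (A ⊗ A) (A : C)) (u : hom (A : C) (A : C)).
Hypothesis Ht : is_opposite_brace_triple m u.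
Notation d := (hopf_coalg A).
Hypothesis Hc : cocommutative d.
Let HA := hopf_axioms A.
Let Hd := hopf_is_coalgebra HA.
Let sym := braid_sym HA Hc.
Let Hs : is_coalgebra_morphism d d (antipode A) := antipode_coalgmor HA Hc.
Let Hm := obt_m_coalgmor Ht.
Let Hu := obt_u_coalgmor Ht.

Definition triple_alg : algebra_data (A : C) := AlgebraData (eta A) (mu_tilde m).

Lemma mu_tilde_pairing X (dX : coalgebra_data X) (x y : hom X A) :
  is_coalgebra dX -> is_coalgebra_morphism dX d x ->
  mu_tilde m ∘ pairing dX x y = mu A ∘ pairing dX x (m ∘ pairing dX x y).
Proof.
move=> HX Hx; rewrite /mu_tilde -!compA tens_pairing (comul_pairing Hx) comp1m.
by rewrite asc_pairing // tens_pairing comp1m.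
Qed.

Lemma mu_tilde_coalgmor : is_coalgebra_morphism (tens_coalgebra d d) d (mu_tilde m).
Proof.
have HHH := tens_coalgebra_axioms Hd Hd; have cHH := cocommutative_tens HA Hc.
have p1 := proj1_coalgmor Hd Hd; have p2 := proj2_coalgmor Hd Hd.
rewrite -[mu_tilde m]compm1 -(pairing_proj Hd Hd) mu_tilde_pairing //.
apply: coalgmor_comp (hopf_mul_coalgmor HA) (pairing_coalgmor HHH cHH p1 _).
exact: coalgmor_comp Hm (pairing_coalgmor HHH cHH p1 p2).
Qed.

Section AtPoints.
Variables (X : C) (dX : coalgebra_data X).
Hypotheses (HX : is_coalgebra dX) (cX : cocommutative dX).
Let mul := mul_point HX cX (hopf_mul_coalgmor HA).
Let add := mul_point HX cX mu_tilde_coalgmor.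
Let one := unit_point HX (hopf_unit_coalgmor HA).
Let inv := map_point (dX := dX) Hs.
Let act := mul_point HX cX Hm.
Let opp := map_point (dX := dX) Hu.

Lemma add_pointE x y : add x y = mul x (act x y).
Proof. by case: x y => [x Hx] [y Hy]; apply: point_eq; exact: mu_tilde_pairing. Qed.

Lemma point_act1 x : act one x = x.
Proof.
case: x => [x Hx]; apply: point_eq => /=.
have := f_equal (fun f => f ∘ pairing dX (coalg_counit dX) x) (obt_m_unitl Ht).
by rewrite -compA tens_pairing comp1m lun_pairing.
Qed.

Lemma point_act_one x : act x one = one.
Proof.
case: x => [x Hx]; apply: point_eq => /=.
have := f_equal (fun f => f ∘ pairing dX x (coalg_counit dX)) (obt_m_unitr Ht).
rewrite -!compA !tens_pairing comp1m /epsilon (coalgmor_counit Hx) lun_pairing //.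
Qed.

Lemma point_actA x y z : act x (act y z) = act (mul y x) z.
Proof.
case: x y z => [x Hx] [y Hy] [z Hz]; apply: point_eq => /=.
have := f_equal (fun f => f ∘ pairing dX x (pairing dX y z)) (obt_m_action Ht).
by rewrite -!compA csa_pairing // !tens_pairing !comp1m /mu_op -compA braid_inv_pairing.
Qed.

Lemma point_actD x y z : act x (add y z) = add (act x y) (act x z).
Proof.
case: x y z => [x Hx] [y Hy] [z Hz]; apply: point_eq => /=.
have := f_equal (fun f => f ∘ pairing dX x (pairing dX y z)) (obt_m_mu_tilde Ht).
(* Generalising [mu_tilde m] hides the composite it abbreviates from the reassociation in
   [cartesian]. *)
move: (mu_tilde m) => t; cartesian HX cX; rewrite /delta (comul_pairing Hx).
by cartesian HX cX.
Qed.

Lemma point_oppK x : opp (opp x) = x.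
Proof.
by case: x => [x Hx]; apply: point_eq; rewrite /= compA (obt_u_invol Ht) comp1m.
Qed.

Lemma point_act_opp x : act x (opp x) = inv x.
Proof.
case: x => [x Hx]; apply: point_eq; rewrite /= -(obt_m_antipode Ht) -!compA.
by rewrite /delta (comul_pairing Hx) tens_pairing comp1m.
Qed.

Let Gm : is_group mul one inv := hopf_point_group HA Hs HX cX.
Let actD x y z : act x (mul y (act y z)) = mul (act x y) (act (act x y) (act x z)).
Proof. by rewrite -!add_pointE point_actD. Qed.

Lemma triple_points_group : is_group add one opp.
Proof.
have e x y := add_pointE x y.
have G := triple_group Gm point_act1 point_act_one point_actA actD point_oppK point_act_opp.
case: G => A1 A2 A3 A4 A5; split=> *; rewrite ?e; auto.
Qed.

Lemma triple_points_act x y :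
  act (inv x) y = add (opp x) (mul x y).
Proof.
rewrite add_pointE.
exact: (triple_act Gm point_act1 point_act_one point_actA actD point_oppK point_act_opp).
Qed.

Lemma triple_points_brace x y z :
  mul x (add y z) = add (mul x y) (add (opp x) (mul x z)).
Proof.
rewrite !add_pointE.
exact: (triple_brace Gm point_act1 point_act_one point_actA actD point_oppK point_act_opp).
Qed.
End AtPoints.

Lemma triple_hopf : is_hopf_algebra triple_alg d u.
Proof.
refine (@hopf_of_point_groups C A d triple_alg u Hd Hc sym (hopf_unit_coalgmor HA)
  mu_tilde_coalgmor Hu _).
exact: triple_points_group.
Qed.

Notation pt x Hx := (exist _ x Hx : point _ d).

Lemma triple_compat :
  let Gamma := mu_tilde m ∘ (u ⊠ mu A) ∘ asc A A A ∘ (delta A ⊠ idm (A : C)) in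
  mu A ∘ (idm (A : C) ⊠ mu_tilde m) =
  mu_tilde m ∘ (mu A ⊠ Gamma) ∘ midswap A A A A ∘ (delta A ⊠ idm (A ⊗ A)).
Proof.
apply: (eq_points3 Hd Hc sym) => X dX HX cX x y z Hx Hy Hz.
have := triple_points_brace HX cX (pt _ Hx) (pt _ Hy) (pt _ Hz).
move/(f_equal (@proj1_sig _ _)) => /=; rewrite /delta.
move: (mu_tilde m) => t; cartesian HX cX; rewrite (comul_pairing Hx).
by cartesian HX cX; rewrite (comul_pairing Hx); cartesian HX cX.
Qed.

Definition triple_brace_of : hopf_brace C := HopfBrace triple_hopf HA triple_compat.

Lemma triple_action : brace_action triple_brace_of = m.
Proof.
apply: (eq_points2 Hd Hc sym) => X dX HX cX x y Hx Hy.
rewrite brace_actionE -compA tens_pairing comp1m brace_gamma_pairing //.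
  exact: coalgmor_comp Hs Hx.
(* [brace_action] evaluates [gamma] at the inverse of x, and [gamma] is m at an inverse; the two
   inversions cancel. *)
have := triple_points_act HX cX (map_point Hs (pt _ Hx)) (pt _ Hy).
rewrite (group_invK (hopf_point_group HA Hs HX cX)).
by move/(f_equal (@proj1_sig _ _)) => /= ->.
Qed.

End TripleToBrace.

(** * The isomorphism of categories *)

(** Casts along [e] replace a heterogeneous equality of the morphism parts. Once the object maps are
    identified, each [e A] equates an object with itself, so its cast is an identity. *)
Lemma functor_eq (C D : category) (F G : functor C D) (e : forall A, F A = G A) :
  (forall A B (f : hom A B), idto (e B) ∘ fhom F f = fhom G f ∘ idto (e A)) -> F = G.
Proof.
case: F G e => [F0 F1 F11 F1M] [G0 G1 G11 G1M] /= e.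
have e0 : F0 = G0 by apply: functional_extensionality.
case: G0 / e0 G1 G11 G1M e => G1 G11 G1M e H.
have e1 : F1 = G1.
  apply: functional_extensionality_dep => A; apply: functional_extensionality_dep => B.
  apply: functional_extensionality_dep => f.
  by have := H _ _ f; rewrite !idto_id comp1m compm1.
case: G1 / e1 G11 G1M {H} => G11 G1M.
by rewrite (proof_irrelevance _ G11 F11) (proof_irrelevance _ G1M F1M).
Qed.

Section Isomorphism.
Variable C : strict_braided_category.

Lemma brace_action_morphism (H B : hopf_brace C) (f : hom (hb_ob H) (hb_ob B)) :
  is_hopf_brace_morphism f ->
  f ∘ brace_action H = brace_action B ∘ (f ⊠ f).
Proof.
move=> [f1 f2].
have := hopf_morphism_antipode f1; have := hopf_morphism_antipode f2 => /= e2 e1.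
have := algmor_mul (hopfmor_alg f1); have := algmor_mul (hopfmor_alg f2) => /= m2 m1.
have := coalgmor_comul (hopfmor_coalg f1) => /= c.
have E1 : (f ⊠ f) ∘ (hb_antipode1 H ⊠ alg_mul (hb_alg2 H)) =
    (hb_antipode1 B ⊠ alg_mul (hb_alg2 B)) ∘ (f ⊠ (f ⊠ f)) by rewrite -!tensmM e1 m2.
have E2 : ((f ⊠ f) ⊠ f) ∘ (coalg_comul (hb_coalg H) ⊠ idm _) =
    (coalg_comul (hb_coalg B) ⊠ idm _) ∘ (f ⊠ f) by rewrite -!tensmM c comp1m compm1.
have E3 : (f ⊠ f) ∘ (hb_antipode2 H ⊠ idm _) = (hb_antipode2 B ⊠ idm _) ∘ (f ⊠ f).
  by rewrite -!tensmM e2 comp1m compm1.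
rewrite !brace_actionE /brace_gamma -!compA (comp_rw m1) -compA (comp_rw E1) -compA.
by rewrite (comp_rw (esym (ascN _ _ _))) -compA (comp_rw E2) -compA E3.
Qed.

Lemma mu_tilde_morphism (A B : opposite_brace_triple C)
    (f : hom (obt_hopf A : C) (obt_hopf B)) :
  is_opposite_brace_triple_morphism f ->
  f ∘ mu_tilde (obt_m A) = mu_tilde (obt_m B) ∘ (f ⊠ f).
Proof.
move=> [[[_ fm] [_ fd]] fact].
have E1 : (f ⊠ f) ∘ (idm _ ⊠ obt_m A) = (idm _ ⊠ obt_m B) ∘ (f ⊠ (f ⊠ f)).
  by rewrite -!tensmM fact comp1m compm1.
have E2 : ((f ⊠ f) ⊠ f) ∘ (delta (obt_hopf A) ⊠ idm _) =
    (delta (obt_hopf B) ⊠ idm _) ∘ (f ⊠ f) by rewrite -!tensmM -fd comp1m compm1.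
rewrite /mu_tilde -!compA (comp_rw fm) -compA (comp_rw E1) -compA.
by rewrite (comp_rw (esym (ascN _ _ _))) -compA E2.
Qed.

Definition triple_of_brace (H : hopf_brace C) (Hc : cocommutative (hb_coalg H)) :
    opposite_brace_triple C := OppositeBraceTriple (brace_is_triple Hc).

Definition brace_of_triple (A : opposite_brace_triple C)
    (Hc : cocommutative (hopf_coalg (obt_hopf A))) : hopf_brace C :=
  triple_brace_of (obt_axioms A) Hc.

Lemma triple_of_brace_morphism (H B : hopf_brace C) Hc Bc
    (f : hom (hb_ob H) (hb_ob B)) :
  is_hopf_brace_morphism f ->
  @is_opposite_brace_triple_morphism C (@triple_of_brace H Hc) (@triple_of_brace B Bc) f.
Proof. by move=> Hf; split; [case: Hf | exact: brace_action_morphism]. Qed.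

Lemma brace_of_triple_morphism (A B : opposite_brace_triple C) Ac Bc
    (f : hom (obt_hopf A : C) (obt_hopf B)) :
  is_opposite_brace_triple_morphism f ->
  @is_hopf_brace_morphism C (@brace_of_triple A Ac) (@brace_of_triple B Bc) f.
Proof.
move=> Hf; have [[[fu fm] fc] _] := Hf; split; split=> //; split=> //.
exact: mu_tilde_morphism.
Qed.

Definition cocHBr_to_opBT : functor (cocHBr C) (coc_opBT C).
Proof.
refine (@Functor (cocHBr C) (coc_opBT C)
  (fun H => exist _ (triple_of_brace (proj2_sig H)) (proj2_sig H))
  (fun H B f => exist _ (proj1_sig f)
     (triple_of_brace_morphism (proj2_sig H) (proj2_sig B) (proj2_sig f))) _ _).
- by move=> H; apply: subset_eq_compat.
- by move=> H B D g f; apply: subset_eq_compat.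
Defined.

Definition opBT_to_cocHBr : functor (coc_opBT C) (cocHBr C).
Proof.
refine (@Functor (coc_opBT C) (cocHBr C)
  (fun A => exist _ (brace_of_triple (proj2_sig A)) (proj2_sig A))
  (fun A B f => exist _ (proj1_sig f)
     (brace_of_triple_morphism (proj2_sig A) (proj2_sig B) (proj2_sig f))) _ _).
- by move=> A; apply: subset_eq_compat.
- by move=> A B D g f; apply: subset_eq_compat.
Defined.

(** In the round trip from braces, all data except the algebra of H_1 come back by conversion. *)
Lemma hopf_brace_eq (H : hopf_brace C) (a1 : algebra_data (hb_ob H)) h1 compat :
  a1 = hb_alg1 H ->
  @HopfBrace C (hb_ob H) (hb_coalg H) a1 (hb_antipode1 H) (hb_alg2 H) (hb_antipode2 H)
    h1 (hb_hopf2 H) compat = H.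
Proof.
case: H a1 h1 compat => o d a1 s1 a2 s2 h1 h2 c /= a1' h1' c' e.
move: h1' c'; rewrite e => h1' c'.
by rewrite (proof_irrelevance _ h1' h1) (proof_irrelevance _ c' c).
Qed.

Lemma brace_of_tripleK (H : hopf_brace C) (Hc : cocommutative (hb_coalg H)) :
  @brace_of_triple (triple_of_brace Hc) Hc = H.
Proof.
apply: hopf_brace_eq.
rewrite /triple_alg /= brace_mu_tilde // /eta /= -(brace_eta Hc).
by case: (hb_alg1 H).
Qed.

Lemma triple_eq (A : hopf_algebra C) (m m' : hom (A ⊗ A) (A : C)) (u : hom (A : C) A)
    (t : is_opposite_brace_triple m u) (t' : is_opposite_brace_triple m' u) :
  m = m' -> OppositeBraceTriple t = OppositeBraceTriple t'.
Proof. by move=> e; case: m' / e t' => t'; rewrite (proof_irrelevance _ t' t). Qed.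

Lemma triple_of_braceK (A : opposite_brace_triple C)
    (Hc : cocommutative (hopf_coalg (obt_hopf A))) :
  @triple_of_brace (brace_of_triple Hc) Hc = A.
Proof.
(* With the records taken apart, the rebuilt Hopf algebra and u are convertible to the given ones
   and only m differs. *)
case: A Hc => [[o a d s HA] m u t] Hc.
apply: triple_eq.
exact: triple_action.
Qed.

Lemma cocHBr_idto (A B : cocHBr C) (e : A = B) :
  proj1_sig (idto e : hom A B) = idto (f_equal (fun A => hb_ob (proj1_sig A)) e).
Proof. by case: B / e. Qed.

Lemma coc_opBT_idto (A B : coc_opBT C) (e : A = B) :
  proj1_sig (idto e : hom A B) =
  idto (f_equal (fun A => hopf_ob (obt_hopf (proj1_sig A))) e).
Proof. by case: B / e. Qed.

End Isomorphism.

Theorem theorem3p11 (C : strict_braided_category) :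
  isomorphic_categories (cocHBr C) (coc_opBT C).
Proof.
exists (cocHBr_to_opBT C), (opBT_to_cocHBr C); split.
- have e (H : cocHBr C) : functor_comp (opBT_to_cocHBr C) (cocHBr_to_opBT C) H = functor_id _ H.
    by case: H => H Hc; apply: subset_eq_compat; exact: brace_of_tripleK.
  (* The round trip preserves the underlying object by conversion, so the underlying cast goes from
     an object to itself. *)
  have e1 H : proj1_sig (idto (e H)) = idm (hb_ob (proj1_sig H)).
    by rewrite cocHBr_idto; exact: idto_id.
  apply: (functor_eq (e := e)) => H B f.
  apply: eq_sig_hprop; first by move=> *; exact: proof_irrelevance.
  rewrite -[LHS]/(proj1_sig (idto (e B)) ∘ proj1_sig f) e1 comp1m.
  by rewrite -[RHS]/(proj1_sig f ∘ proj1_sig (idto (e H))) e1 compm1.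
- have e (A : coc_opBT C) :
      functor_comp (cocHBr_to_opBT C) (opBT_to_cocHBr C) A = functor_id _ A.
    by case: A => A Ac; apply: subset_eq_compat; exact: triple_of_braceK.
  have e1 A : proj1_sig (idto (e A)) = idm (hopf_ob (obt_hopf (proj1_sig A))).
    by rewrite coc_opBT_idto; exact: idto_id.
  apply: (functor_eq (e := e)) => A B f.
  apply: eq_sig_hprop; first by move=> *; exact: proof_irrelevance.
  rewrite -[LHS]/(proj1_sig (idto (e B)) ∘ proj1_sig f) e1 comp1m.
  by rewrite -[RHS]/(proj1_sig f ∘ proj1_sig (idto (e A))) e1 compm1.
Qed.
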